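(* Let $d\ge2$, $\lambda_n>0$, $\beta_n\in\mathbb{R}$ ($n\ge0$), and assume the Jacobi operator $J$ on $\ell^2(\Gamma_d)$ is not essentially selfadjoint. Let $z\in\mathbb{C}\setminus\mathbb{R}$. Then the algebraic direct sum $$\bigoplus_{x\in\Gamma_d\cup\{0\}}A_x=\operatorname{lin}\{g_x:\ g_x\in A_x,\ x\in\Gamma_d\cup\{0\}\}$$ of the pairwise orthogonal spaces $A_x$ is dense in the (nontrivial) deficiency space $N_z(J)$.
   Context: $\Gamma_d$ is the vertex set of the infinite rooted tree with root $e$ in which every vertex $x$ has exactly $d$ successors (children) $x_1,\dots,x_d$ and every $x\ne e$ has exactly one predecessor $x_0$; $|x|$ is the distance from $x$ to $e$; $\Gamma_x$ is the subtree consisting of $x$ and all its descendants. $\ell^2(\Gamma_d)$ is the complex Hilbert space of square-summable functions. $J$ has domain the finitely supported functions and acts by $J\delta_x=\lambda_{n-1}\delta_{x_0}+\beta_n\delta_x+\lambda_n(\delta_{x_1}+\dots+\delta_{x_d})$, $n=|x|$, with the first term absent for $x=e$ ($\lambda_{-1}=0$). The deficiency space is $N_z(J)=(\operatorname{Im}(J-\bar zI))^{\perp}$. For $x\in\Gamma_d$ with $|x|=k$, $f_x:\Gamma_d\to\mathbb{C}$ is the function vanishing outside $\Gamma_x$ with $f_x(y)=v_{|y|}$ for $y\in\Gamma_x$, where $(v_n)_{n\ge k}$ is determined by $v_k=1$, $zv_k=\beta_kv_k+d\lambda_kv_{k+1}$, and $zv_n=\lambda_{n-1}v_{n-1}+\beta_nv_n+d\lambda_nv_{n+1}$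 for $n>k$. (Under the assumption that $J$ is not essentially selfadjoint, $f_x\in\ell^2(\Gamma_d)$.) For $x\in\Gamma_d$ put $$A_x=\Big\{\sum_{i=1}^da_if_{x_i}:\ a_i\in\mathbb{C},\ \sum_{i=1}^da_i=0\Big\},$$ and, for the extra index symbol $0\notin\Gamma_d$, $A_0=\{a f_e: a\in\mathbb{C}\}$. *)

(* Defs.v *)
From HB Require Import structures.
From mathcomp Require Import all_boot all_order all_algebra.
From mathcomp Require Import all_classical all_reals all_analysis.
From mathcomp Require Import complex ring.

Set Implicit Arguments.
Unset Strict Implicit.
Unset Printing Implicit Defensive.

Import Order.TTheory GRing.Theory Num.Theory.
Local Open Scope classical_set_scope.
Local Open Scope complex_scope.
Local Open Scope ring_scope.

Section Hilbert.
Variables (R : realType) (T : choiceType).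
Local Notation C := R[i].
Local Notation V := (T -> C).

(* Unordered sums of absolutely summable families; the values are meaningful
   only under absolute summability, which holds for f * g^* with f, g in l^2. *)
Definition rsum (a : T -> R) : R :=
  fine (\esum_(x in [set: T]) ((EFin \o a)^\+ x)%E)
  - fine (\esum_(x in [set: T]) ((EFin \o a)^\- x)%E).

Definition csum (a : V) : C :=
  (rsum (fun x => complex.Re (a x)) +i* rsum (fun x => complex.Im (a x))).

Definition sqmod (c : C) : R := complex.Re c ^+ 2 + complex.Im c ^+ 2.

Definition ell2 : set V :=
  [set f | (\esum_(x in [set: T]) (sqmod (f x))%:E < +oo)%E].

Definition dotl2 (f g : V) : C := csum (fun x => f x * (g x)^*).

Definition norml2 (f : V) : R :=
  Num.sqrt (fine (\esum_(x in [set: T]) (sqmod (f x))%:E)).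

Definition orthocompl (S : set V) : set V :=
  [set h | ell2 h /\ forall g, S g -> dotl2 g h = 0].

Definition lspan (S : set V) : set V :=
  [set h | exists (n : nat) (c : 'I_n -> C) (u : 'I_n -> V),
     (forall i, S (u i)) /\ h = \sum_(i < n) c i *: u i].

Definition dense_in (S N : set V) : Prop :=
  S `<=` N /\
  forall h, N h -> forall e : R, 0 < e -> exists2 g, S g & norml2 (h - g) < e.

(* Operators in l^2 are represented by their graphs. *)
Definition adjoint (G : set (V * V)) : set (V * V) :=
  [set p | [/\ ell2 p.1, ell2 p.2 &
     forall f g, G (f, g) -> dotl2 g p.1 = dotl2 f p.2]].

Definition op_closure (G : set (V * V)) : set (V * V) :=
  [set p | [/\ ell2 p.1, ell2 p.2 &
     forall e : R, 0 < e -> exists f g,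
       [/\ G (f, g), norml2 (p.1 - f) < e & norml2 (p.2 - g) < e]]].

Definition selfadjoint (G : set (V * V)) : Prop := adjoint G = G.

Definition essentially_selfadjoint (G : set (V * V)) : Prop :=
  selfadjoint (op_closure G).

(* Im (G - w I) *)
Definition shifted_range (G : set (V * V)) (w : C) : set V :=
  [set h | exists f g, G (f, g) /\ h = g - w *: f].

Definition deficiency (G : set (V * V)) (z : C) : set V :=
  orthocompl (shifted_range G z^*).

End Hilbert.

Section DirectSum.
Variables (R : realType) (T : choiceType) (I : choiceType).
Local Notation V := (T -> R[i]).

Definition algsum (A : I -> set V) : set V :=
  [set h | exists (D : set I) (g : I -> V),
     [/\ finite_set D, (forall x, D x -> A x (g x)) & h = \sum_(x \in D) g x]].

Definition direct_family (A : I -> set V) : Prop :=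
  forall (D : set I) (g : I -> V), finite_set D ->
    (forall x, D x -> A x (g x)) -> \sum_(x \in D) g x = 0 ->
    forall x, D x -> g x = 0.

Definition orthogonal_family (A : I -> set V) : Prop :=
  forall x y, x != y -> forall g h, A x g -> A y h -> dotl2 g h = 0.

End DirectSum.

(* The vertices are words over 'I_d: the root is [::], the successors of x are
   i :: x, the predecessor of i :: x is x and |x| is size x. The descendants of
   x (x included) are thus the words having x as a suffix. *)
Definition vertex (d : nat) := seq 'I_d.

Section Tree.
Variables (R : realType) (d : nat) (lam beta : nat -> R).
Local Notation C := R[i].
Local Notation V := (vertex d -> C).

Definition delta (x : vertex d) : V := fun y => (y == x)%:R.

Definition Jdelta (x : vertex d) : V :=
  (if x is _ :: x0 then (lam (size x0))%:C *: delta x0 else 0)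
  + (beta (size x))%:C *: delta x
  + (lam (size x))%:C *: \sum_(i < d) delta (i :: x).

Definition finsupp : set V := [set f | finite_set [set x | f x != 0]].

Definition Jop (f : V) : V := \sum_(x \in [set x | f x != 0]) f x *: Jdelta x.

Lemma Jop_delta x : Jop (delta x) = Jdelta x.
Proof.
have -> : Jop (delta x) = \sum_(y \in [set x]) delta x y *: Jdelta y.
  rewrite /Jop; congr (\sum_(y \in _) _); apply/seteqP; split=> y /=.
    by rewrite /delta; case: (y =P x) => // _; rewrite mulr0n eqxx.
  by move=> ->; rewrite /delta eqxx oner_eq0.
by rewrite fsbig_set1 /delta eqxx scale1r.
Qed.

Definition Jacobi : set (V * V) := [set p | finsupp p.1 /\ p.2 = Jop p.1].

Variable z : C.

(* vpair k m = (v_(k+m), v_(k+m-1)) with the convention v_(k-1) = 0. *)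
Fixpoint vpair (k m : nat) : C * C :=
  if m is m'.+1 then
    let p := vpair k m' in
    (((z - (beta (k + m'))%:C) * p.1 - (lam (k + m').-1)%:C * p.2)
       / (d%:R * (lam (k + m'))%:C), p.1)
  else (1, 0).

Definition vseq (k n : nat) : C := (vpair k (n - k)).1.

(* The recurrence defining (v_n)_(n >= k). *)
Definition vspec (k : nat) (v : nat -> C) : Prop :=
  [/\ v k = 1,
      z * v k = (beta k)%:C * v k + d%:R * (lam k)%:C * v k.+1 &
      forall n, (k < n)%N ->
        z * v n = (lam n.-1)%:C * v n.-1 + (beta n)%:C * v n
                  + d%:R * (lam n)%:C * v n.+1].

Lemma vseq_spec (d_gt0 : (0 < d)%N) (lam_gt0 : forall n, 0 < lam n) k :
  vspec k (vseq k).
Proof.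
have nz n : (d%:R * (lam n)%:C : C) != 0.
  rewrite mulf_neq0 ?pnatr_eq0 -?lt0n //.
  by rewrite (inj_eq (@complexI R)) gt_eqF.
split; first by rewrite /vseq subnn.
  rewrite /vseq subnn subSnn /= addn0 mulr0 subr0 [X in _ + X]mulrC divfK //.
  by rewrite !mulr1 addrC subrK.
move=> n /subnKC <-; set m := (n - k.+1)%N.
rewrite addSn -[(k + m).+1.-1]/(k + m)%N /vseq -!addnS !addKn.
have -> : (vpair k m.+2).1 =
    ((z - (beta (k + m.+1))%:C) * (vpair k m.+1).1
     - (lam (k + m))%:C * (vpair k m).1) / (d%:R * (lam (k + m.+1))%:C).
  by rewrite [in LHS]/= addnS.
by rewrite [X in _ = _ + X]mulrC divfK //; ring.
Qed.

Lemma vspec_unique (d_gt0 : (0 < d)%N) (lam_gt0 : forall n, 0 < lam n) k v :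
  vspec k v -> forall n, (k <= n)%N -> v n = vseq k n.
Proof.
have nz n : (d%:R * (lam n)%:C : C) != 0.
  rewrite mulf_neq0 ?pnatr_eq0 -?lt0n //.
  by rewrite (inj_eq (@complexI R)) gt_eqF.
have [w0 w1 wS] := vseq_spec d_gt0 lam_gt0 k.
move=> [v0 v1 vS].
have vw0 : v k = vseq k k by rewrite v0 w0.
have vw1 : v k.+1 = vseq k k.+1.
  apply: (mulfI (nz k)); apply: (addrI ((beta k)%:C * v k)).
  by rewrite -v1 vw0 -w1.
suff H m : v (k + m)%N = vseq k (k + m) /\ v (k + m).+1 = vseq k (k + m).+1.
  by move=> n /subnKC <-; case: (H (n - k)%N).
elim: m => [|m [IH0 IH1]]; first by rewrite addn0 v0 w0.
rewrite addnS; split=> //; apply: (mulfI (nz (k + m).+1)).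
have lt : (k < (k + m).+1)%N by rewrite ltnS leq_addr.
have /= vE := vS _ lt; have /= wE := wS _ lt.
apply: (addrI ((lam (k + m))%:C * v (k + m)%N
               + (beta (k + m).+1)%:C * v (k + m).+1)).
by rewrite -vE IH0 IH1 -wE.
Qed.

Definition fvec (x : vertex d) : V :=
  fun y => if suffix x y then vseq (size x) (size y) else 0.

(* None plays the role of the extra index 0. *)
Definition Aspace (x : option (vertex d)) : set V :=
  match x with
  | Some x => [set g | exists a : 'I_d -> C,
                \sum_(i < d) a i = 0 /\ g = \sum_(i < d) a i *: fvec (i :: x)]
  | None => [set g | exists a : C, g = a *: fvec [::]]
  end.

End Tree.

(* Main.v *)
(* Modulo the range of J - z, the indicator of the m-th generation below x is a
   multiple d^m v_(k+m) of delta_x (k = |x|) plus a multiple of delta_(x_0). If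
   the sums of d^n |v_n|^2 diverged for every k, combining generations with the
   coefficients conj(v_n) / W, of l^2-norm at most a constant times W^(-1/2),
   would put each delta_x in the closure of the ranges of J - z and, by
   conjugation, of J - z^*, so J would be essentially selfadjoint. Hence one
   solution v is square summable, and a Weyl circle argument passes this on to
   all k, so every f_x lies in l^2. The same generation identity shows that u in
   N_z with u(x) = u(x_0) = 0 is orthogonal to f_x, which gives orthogonality of
   the A_x. For density, h in N_z is matched on the levels <= n by some g in the
   span; then h - g vanishes on these levels and is orthogonal to g, so
   |h - g|^2 = <h, h - g> is at most |h - h 1_(levels <= n)| |h - g|. *)

From mathcomp Require Import finmap.
Require Import Defs.
From mathcomp Require Import all_boot all_order all_algebra.
From mathcomp Require Import all_classical all_reals all_analysis.
From mathcomp Require Import complex ring lra.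

Set Implicit Arguments.
Unset Strict Implicit.
Unset Printing Implicit Defensive.

Import Order.TTheory GRing.Theory Num.Theory.
Local Open Scope classical_set_scope.
Local Open Scope complex_scope.
Local Open Scope ring_scope.
Import ComplexField.Normc.

(** On functions of |y| supported in Gamma_x, J is a one-dimensional Jacobi expression plus a single
    leak at x_0. Putting phi_n = d^(n/2) g_n makes that expression symmetric with off-diagonal
    entries sqrt(d) lambda_n, which is the origin of the weights d^n. The leak is absent at the
    root, so the delta_x enter the closure of the range by induction on depth. Selfadjointness is
    reached by explicit approximation, from the estimate |Im w| |f| <= |(J - w) f| and its extension
    to the adjoint. Failure of essential selfadjointness supplies only one starting index k, while
    different k give different solutions. Neighbouring ones, P and T, are compared through T - t P,
    where t depends on the cutoff: an upper bound for |t| moves k up, a positive lower bound moves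
    it down. The condition that the a_i sum to 0 plays two parts. It cancels the leaks of the
    f_(x_i) at their common predecessor x; and it is what J u = z u says at x when u vanishes up to
    level |x|. *)

(** * Unordered real sums and their linearity *)

Section RealSums.
Variables (R : realType) (T : choiceType).
Implicit Types a b p q : T -> R.

Definition l1 a := summable [set: T] (EFin \o a).

Definition nnsum a : R := fine (\esum_(x in [set: T]) (a x)%:E).

Lemma l1_le a b : (forall x, `|a x| <= b x) -> l1 b -> l1 a.
Proof.
move=> ab; apply: le_lt_trans; apply: le_esum => x _ /=.
by rewrite lee_fin; apply: (le_trans (ab x)); exact: ler_norm.
Qed.

Lemma l1D a b : l1 a -> l1 b -> l1 (fun x => a x + b x).
Proof. exact: summableD. Qed.

Lemma l1N a : l1 a -> l1 (fun x => - a x).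
Proof. by rewrite /l1 summableN. Qed.

Lemma l1_ge0 a : (forall x, 0 <= a x) ->
  l1 a <-> (\esum_(x in [set: T]) (a x)%:E < +oo)%E.
Proof.
move=> a0; rewrite /l1 /summable.
suff -> : (\esum_(x in [set: T]) `|(EFin \o a) x|
  = \esum_(x in [set: T]) (a x)%:E)%E by [].
by apply: eq_esum => x _ /=; rewrite ger0_norm.
Qed.

Lemma nnsumK a : (forall x, 0 <= a x) -> l1 a ->
  (nnsum a)%:E = (\esum_(x in [set: T]) (a x)%:E)%E.
Proof.
move=> a0 /(l1_ge0 a0) ha; rewrite fineK// fin_numElt ha andbT.
by apply: lt_le_trans (ltNyr 0) _; apply: esum_ge0 => x _; rewrite lee_fin.
Qed.

Lemma nnsum_ge0 a : (forall x, 0 <= a x) -> 0 <= nnsum a.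
Proof. by move=> a0; apply/fine_ge0/esum_ge0 => x _; rewrite lee_fin. Qed.

Lemma nnsum_le a b : (forall x, 0 <= a x <= b x) -> l1 b -> nnsum a <= nnsum b.
Proof.
move=> ab hb; have a0 x : 0 <= a x by case/andP: (ab x).
have b0 x : 0 <= b x by case/andP: (ab x) => /le_trans; exact.
have ha : l1 a by apply: l1_le hb => x; rewrite ger0_norm//; case/andP: (ab x).
by rewrite -lee_fin !nnsumK//; apply: le_esum => x _; rewrite lee_fin;
  case/andP: (ab x).
Qed.

Lemma nnsumD a b : (forall x, 0 <= a x) -> (forall x, 0 <= b x) ->
  l1 a -> l1 b -> nnsum (fun x => a x + b x) = nnsum a + nnsum b.
Proof.
move=> a0 b0 ha hb; apply/EFin_inj.
rewrite EFinD !nnsumK//; last first.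
- exact: l1D.
- by move=> x; rewrite addr_ge0.
by rewrite -esumD// => x _; rewrite lee_fin.
Qed.

Lemma nnsum_ub a B : (forall x, 0 <= a x) ->
  (forall X : set T, finite_set X -> \sum_(x \in X) a x <= B) ->
  l1 a /\ nnsum a <= B.
Proof.
move=> a0 hB.
have hle : (\esum_(x in [set: T]) (a x)%:E <= B%:E)%E.
  apply: ge_ereal_sup => _ [X [finX _] <-] /=.
  by rewrite fsumEFin// lee_fin hB.
have ha : l1 a by apply/l1_ge0 => //; exact: le_lt_trans hle (ltry _).
by split => //; rewrite -lee_fin nnsumK.
Qed.

Lemma nnsum_lb a (X : set T) : (forall x, 0 <= a x) -> l1 a -> finite_set X ->
  \sum_(x \in X) a x <= nnsum a.
Proof.
move=> a0 ha finX; rewrite -lee_fin nnsumK//.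
apply: esum_ge; exists X; first by split.
by rewrite fsumEFin.
Qed.

Lemma nnsum_approx a e : (forall x, 0 <= a x) -> l1 a -> 0 < e ->
  exists2 X : set T, finite_set X & nnsum a - e < \sum_(x \in X) a x.
Proof.
move=> a0 ha e0; apply: contrapT => H.
suff [_] : l1 a /\ nnsum a <= nnsum a - e by rewrite lerBrDr gerDl leNgt e0.
apply: nnsum_ub => // X finX; rewrite leNgt; apply/negP => lt; apply: H.
by exists X.
Qed.

Lemma nnsumZ c a : 0 <= c -> (forall x, 0 <= a x) -> l1 a ->
  l1 (fun x => c * a x) /\ nnsum (fun x => c * a x) = c * nnsum a.
Proof.
have aux k b : 0 <= k -> (forall x, 0 <= b x) -> l1 b ->
    l1 (fun x => k * b x) /\ nnsum (fun x => k * b x) <= k * nnsum b.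
  move=> k0 b0 hb; apply: nnsum_ub => [x|X finX]; first exact: mulr_ge0.
  by rewrite -mulr_fsumr ler_wpM2l// nnsum_lb.
move=> c0 a0 ha; have [hca le1] := aux _ _ c0 a0 ha; split => //.
have [->|cn0] := eqVneq c 0.
  rewrite mul0r /nnsum esum1//= => x _; by rewrite mul0r.
have cp : 0 < c by rewrite lt_neqAle eq_sym cn0.
apply/le_anti/andP; split => //.
have ca0 x : 0 <= c * a x by rewrite mulr_ge0.
(* The inequality of [aux] for the inverse factor is the missing reverse inequality. *)
have [|_] := aux c^-1 (fun x => c * a x) _ ca0 hca; first by rewrite invr_ge0.
rewrite -(ler_pM2l cp) mulVKf//; congr (_ * nnsum _ <= _).
by apply: funext => x; rewrite mulKf.
Qed.

(** Pointwise p + (p - q)^- = q + (p - q)^+, and [nnsumD] applies to both sides. Thus any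
    nonnegative summable splitting computes [rsum], and linearity does not have to follow positive
    parts through an addition. *)
Lemma rsum_sub p q : (forall x, 0 <= p x) -> (forall x, 0 <= q x) ->
  l1 p -> l1 q -> rsum (fun x => p x - q x) = nnsum p - nnsum q.
Proof.
move=> p0 q0 hp hq.
have hpos : l1 (fun x => Num.max (p x - q x) 0).
  apply: l1_le hp => x; rewrite ger0_norm ?le_max ?lexx ?orbT//.
  by rewrite ge_max p0 andbT lerBlDr lerDl.
have hneg : l1 (fun x => Num.max (- (p x - q x)) 0).
  apply: l1_le hq => x; rewrite ger0_norm ?le_max ?lexx ?orbT//.
  by rewrite ge_max q0 andbT opprB lerBlDr lerDl.
have mx0 (r : R) : 0 <= Num.max r 0 by rewrite le_max lexx orbT.
have E1 : (\esum_(x in [set: T]) ((EFin \o (fun x => p x - q x)%R)^\+ x))%E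
   = (nnsum (fun x => Num.max (p x - q x) 0))%:E.
  by rewrite nnsumK//; apply: eq_esum => x _; rewrite funeposE -EFin_max.
have E2 : (\esum_(x in [set: T]) ((EFin \o (fun x => p x - q x)%R)^\- x))%E
   = (nnsum (fun x => Num.max (- (p x - q x)) 0))%:E.
  by rewrite nnsumK//; apply: eq_esum => x _; rewrite funenegE -EFin_max.
rewrite /rsum E1 E2 /=; apply/eqP; rewrite subr_eq addrAC eq_sym subr_eq.
rewrite -!nnsumD//; apply/eqP; congr nnsum; apply: funext => x.
by rewrite /Num.max; do 2 case: ifPn => //; rewrite -?leNgt => ? ?; lra.
Qed.

Lemma l1_pos a : l1 a -> l1 (fun x => Num.max (a x) 0).
Proof.
move=> ha; have hna : l1 (fun x => `|a x|).
  by move: ha; rewrite /l1 /summable/=; under eq_esum do rewrite -normr_id.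
apply: l1_le hna => x; rewrite ger0_norm ?le_max ?lexx ?orbT//.
by rewrite ge_max normr_ge0 ler_norm.
Qed.

Lemma rsumD a b : l1 a -> l1 b -> rsum (fun x => a x + b x) = rsum a + rsum b.
Proof.
move=> ha hb.
have mx0 (r : R) : 0 <= Num.max r 0 by rewrite le_max lexx orbT.
have E c : l1 c -> rsum c = nnsum (fun x => Num.max (c x) 0)
    - nnsum (fun x => Num.max (- c x) 0).
  move=> hc; rewrite -rsum_sub//; [|exact: l1_pos|exact/l1_pos/l1N].
  congr rsum; apply: funext => x.
  by rewrite /Num.max; do 2 case: ifPn => //; rewrite -?leNgt => ? ?; lra.
have ? := l1_pos ha; have ? := l1_pos hb.
have ? := l1_pos (l1N ha); have ? := l1_pos (l1N hb).
rewrite (E a)// (E b)// addrACA -opprD -!nnsumD// -rsum_sub//.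
- congr rsum; apply: funext => x.
  by rewrite /Num.max; do 4 case: ifPn => //; rewrite -?leNgt => *; lra.
- by move=> x; rewrite addr_ge0.
- by move=> x; rewrite addr_ge0.
- exact: l1D.
- exact: l1D.
Qed.

Lemma rsum_ge0 a : (forall x, 0 <= a x) -> l1 a -> rsum a = nnsum a.
Proof.
move=> a0 ha; have h0 : l1 (fun=> 0 : R) by rewrite /l1 /summable esum1//= => x _; rewrite normr0.
rewrite -[RHS]subr0 -[X in _ - X](_ : nnsum (fun=> 0) = 0); last first.
  by rewrite /nnsum esum1.
by rewrite -rsum_sub//; congr rsum; apply: funext => x; rewrite subr0.
Qed.

Lemma rsumN a : rsum (fun x => - a x) = - rsum a.
Proof.
rewrite /rsum opprB; congr (fine _ - fine _); apply: eq_esum => x _;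
  by rewrite funeposE funenegE/= ?opprK.
Qed.

Lemma rsumZ c a : l1 a ->
  l1 (fun x => c * a x) /\ rsum (fun x => c * a x) = c * rsum a.
Proof.
wlog c0 : c / 0 <= c => [H|] ha.
  have [c0|/ltW c0] := leP 0 c; first exact: H.
  have [||h1 h2] := H (- c); rewrite ?oppr_ge0//.
  split; first by move: (l1N h1); congr l1; apply: funext => x; rewrite mulNr opprK.
  apply: oppr_inj; rewrite -mulNr -h2 -rsumN; congr rsum.
  by apply: funext => x; rewrite mulNr.
have mx0 (r : R) : 0 <= Num.max r 0 by rewrite le_max lexx orbT.
have hp := l1_pos ha; have hn := l1_pos (l1N ha).
have [h1 e1] := nnsumZ c0 (fun x => mx0 (a x)) hp.
have [h2 e2] := nnsumZ c0 (fun x => mx0 (- a x)) hn.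
have E : a = (fun x => Num.max (a x) 0 - Num.max (- a x) 0).
  apply: funext => x.
  by rewrite /Num.max; do 2 case: ifPn => //; rewrite -?leNgt => ? ?; lra.
have E' : (fun x => c * a x) =
  (fun x => c * Num.max (a x) 0 - c * Num.max (- a x) 0).
  by apply: funext => x; rewrite -mulrBr [in LHS]E.
split; first by rewrite E'; apply: l1D => //; exact: l1N.
rewrite E' rsum_sub//.
- by rewrite e1 e2 [in RHS]E rsum_sub// mulrBr.
- by move=> x; rewrite mulr_ge0.
- by move=> x; rewrite mulr_ge0.
Qed.

Lemma rsum_point y r : l1 (fun x => if x == y then r else 0) /\
  rsum (fun x => if x == y then r else 0) = r.
Proof.
have E (s : R) : 0 <= s ->
    (\esum_(x in [set: T]) (if x == y then s else 0)%:E = s%:E)%E.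
  move=> s0; rewrite -(esum_set1 (t := y) (a := fun=> s%:E)) ?lee_fin//.
  rewrite [RHS]esum_mkcond; apply: eq_esum => x _.
  by rewrite in_set1 (fun_if EFin).
have h (s : R) : 0 <= s -> l1 (fun x => if x == y then s else 0).
  by move=> s0; apply/l1_ge0; [move=> x; case: ifP|rewrite E ?ltry].
have mx0 (s : R) : 0 <= Num.max s 0 by rewrite le_max lexx orbT.
have F : (fun x => if x == y then r else 0)
   = (fun x => (if x == y then Num.max r 0 else 0) -
               (if x == y then Num.max (- r) 0 else 0)).
  apply: funext => x; case: ifP; rewrite ?subr0// => _.
  by rewrite /Num.max; do 2 case: ifPn => //; rewrite -?leNgt => ? ?; lra.
rewrite F; split; first by apply: l1D; [|apply: l1N]; exact: h.
rewrite rsum_sub; [|by move=> x; case: ifP|by move=> x; case: ifP|exact: h|exact: h].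
rewrite /nnsum !E//= /Num.max.
by do 2 case: ifPn => //; rewrite -?leNgt => ? ?; lra.
Qed.

End RealSums.

(** * Arithmetic of complex moduli and conjugates *)

Section ComplexModulus.
Variable R : realType.
Implicit Types c u v : R[i].

Lemma complex_eqP u v : complex.Re u = complex.Re v ->
  complex.Im u = complex.Im v -> u = v.
Proof. by case: u v => ? ? [? ?] /= -> ->. Qed.

Lemma sqmodE c : sqmod c = normc c ^+ 2.
Proof. by case: c => a b; rewrite /sqmod/= sqr_sqrtr// addr_ge0// sqr_ge0. Qed.

Lemma sqmod_ge0 c : 0 <= sqmod c.
Proof. by rewrite addr_ge0// sqr_ge0. Qed.

Lemma sqmodM u v : sqmod (u * v) = sqmod u * sqmod v.
Proof. by case: u v => a b [p q]; rewrite /sqmod/=; ring. Qed.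

Lemma sqmodN u : sqmod (- u) = sqmod u.
Proof. by case: u => a b; rewrite /sqmod/=; ring. Qed.

Lemma sqmodJ u : sqmod u^* = sqmod u.
Proof. by case: u => a b; rewrite /sqmod/=; ring. Qed.

Lemma sqmod0 : sqmod (0 : R[i]) = 0.
Proof. by rewrite /sqmod/=; ring. Qed.

Lemma sqmod1 : sqmod (1 : R[i]) = 1.
Proof. by rewrite /sqmod/=; ring. Qed.

Lemma sqmodD_le u v : sqmod (u + v) <= 2 * (sqmod u + sqmod v).
Proof.
case: u v => a b [p q]; rewrite /sqmod/=.
have := sqr_ge0 (a - p); have := sqr_ge0 (b - q); rewrite !expr2; nra.
Qed.

Lemma mulcJ c : c * c^* = (sqmod c)%:C.
Proof. by apply: complex_eqP; case: c => a b; rewrite /sqmod /=; ring. Qed.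

Lemma normc_ge0 c : 0 <= normc c.
Proof. by case: c => a b; exact: sqrtr_ge0. Qed.

Lemma normcR (r : R) : normc (r%:C) = `|r|.
Proof. by rewrite /normc/= expr0n addr0 sqrtr_sqr. Qed.

Lemma Re_le_normc c : complex.Re c <= normc c.
Proof.
case: c => a b /=; apply: (le_trans (ler_norm a)).
by rewrite -sqrtr_sqr ler_wsqrtr// lerDl sqr_ge0.
Qed.

Lemma normc_Im c : `|complex.Im c| <= normc c.
Proof.
by case: c => a b /=; rewrite -sqrtr_sqr ler_wsqrtr// lerDr sqr_ge0.
Qed.

Lemma ReD u v : complex.Re (u + v) = complex.Re u + complex.Re v.
Proof. by case: u v => ? ? [? ?]. Qed.

Lemma ImD u v : complex.Im (u + v) = complex.Im u + complex.Im v.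
Proof. by case: u v => ? ? [? ?]. Qed.

Lemma ReM u v : complex.Re (u * v) =
  complex.Re u * complex.Re v - complex.Im u * complex.Im v.
Proof. by case: u v => ? ? [? ?]. Qed.

Lemma ImM u v : complex.Im (u * v) =
  complex.Re u * complex.Im v + complex.Im u * complex.Re v.
Proof. by case: u v => ? ? [? ?]. Qed.

Lemma ReJ u : complex.Re u^* = complex.Re u.
Proof. by case: u. Qed.

Lemma ImJ u : complex.Im u^* = - complex.Im u.
Proof. by case: u. Qed.

Lemma conjCr (r : R) : (r%:C)^* = r%:C.
Proof. exact: conjc_real. Qed.

Lemma conjcD u v : (u + v)^* = u^* + v^*.
Proof. by apply: complex_eqP; case: u v => a b [p q] /=; rewrite ?opprD. Qed.

Lemma conjcM u v : (u * v)^* = u^* * v^*.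
Proof. by apply: complex_eqP; case: u v => a b [p q] /=; ring. Qed.

Lemma conjcN u : (- u)^* = - u^*.
Proof. by case: u. Qed.

Lemma conjcB u v : (u - v)^* = u^* - v^*.
Proof. by rewrite conjcD conjcN. Qed.

End ComplexModulus.

(** * The inner product and norm of l^2 *)

Section SquareSummable.
Variables (R : realType) (T : choiceType).
Local Notation V := (T -> R[i]).
Implicit Types (f g h : V) (c : R[i]).

Definition l1c (a : V) :=
  l1 (fun x => complex.Re (a x)) /\ l1 (fun x => complex.Im (a x)).

Lemma csumD (a b : V) : l1c a -> l1c b -> csum (a + b) = csum a + csum b.
Proof.
move=> [ar ai] [br bi]; apply: complex_eqP => /=.
  by rewrite -rsumD//; congr rsum; apply: funext => x; rewrite -ReD.
by rewrite -rsumD//; congr rsum; apply: funext => x; rewrite -ImD.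
Qed.

Lemma csumZ c (a : V) : l1c a -> csum (fun x => c * a x) = c * csum a.
Proof.
move=> [ar ai]; apply: complex_eqP => /=.
  rewrite ReM -(rsumZ _ ar).2 -(rsumZ _ ai).2 -rsumN -rsumD.
  - by congr rsum; apply: funext => x; rewrite ReM.
  - exact: (rsumZ _ ar).1.
  - exact/l1N/(rsumZ _ ai).1.
rewrite ImM -(rsumZ _ ar).2 -(rsumZ _ ai).2 -rsumD.
- by congr rsum; apply: funext => x; rewrite ImM.
- exact: (rsumZ _ ai).1.
- exact: (rsumZ _ ar).1.
Qed.

Lemma csumJ (a : V) : csum (fun x => (a x)^*) = (csum a)^*.
Proof.
apply: complex_eqP => /=; first by congr rsum; apply: funext => x; rewrite ReJ.
by rewrite -rsumN; congr rsum; apply: funext => x; rewrite ImJ.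
Qed.

Lemma csum_point (y : T) c : csum (fun x => if x == y then c else 0) = c.
Proof.
apply: complex_eqP => /=; rewrite -[RHS](rsum_point y _).2; congr rsum;
  by apply: funext => x; case: ifP.
Qed.

Definition nsq f : R := nnsum (fun x => sqmod (f x)).

Lemma nsq_ge0 f : 0 <= nsq f.
Proof. by apply: nnsum_ge0 => x; exact: sqmod_ge0. Qed.

Lemma norml2E f : norml2 f = Num.sqrt (nsq f). Proof. by []. Qed.

Lemma norml2_ge0 f : 0 <= norml2 f. Proof. exact: sqrtr_ge0. Qed.

Lemma sqr_norml2 f : norml2 f ^+ 2 = nsq f.
Proof. by rewrite sqr_sqrtr// nsq_ge0. Qed.

Lemma ell2_l1 f : ell2 f <-> l1 (fun x => sqmod (f x)).
Proof. by rewrite (l1_ge0 (fun x => sqmod_ge0 (f x))). Qed.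

Lemma ell2_le f h : (forall x, sqmod (f x) <= sqmod (h x)) -> ell2 h ->
  ell2 f /\ nsq f <= nsq h.
Proof.
move=> fh /ell2_l1 hh; split.
  by apply/ell2_l1; apply: l1_le hh => x; rewrite ger0_norm ?sqmod_ge0.
by apply: nnsum_le => // x; rewrite sqmod_ge0 fh.
Qed.

Lemma ell2Z c f : ell2 f -> ell2 (c *: f).
Proof.
move=> /ell2_l1 hf; apply/ell2_l1.
have [+ _] := nnsumZ (sqmod_ge0 c) (fun x => sqmod_ge0 (f x)) hf.
by congr l1; apply: funext => x; rewrite -sqmodM.
Qed.

Lemma nsqZ c f : ell2 f -> nsq (c *: f) = sqmod c * nsq f.
Proof.
move=> /ell2_l1 hf; rewrite -(nnsumZ (sqmod_ge0 c) (fun x => sqmod_ge0 (f x)) hf).2.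
by congr nnsum; apply: funext => x; rewrite -sqmodM.
Qed.

Lemma ell2D f g : ell2 f -> ell2 g -> ell2 (f + g).
Proof.
move=> /ell2_l1 hf /ell2_l1 hg; apply/ell2_l1.
have fg0 x : 0 <= sqmod (f x) + sqmod (g x) by rewrite addr_ge0// sqmod_ge0.
have [h _] := nnsumZ (ler0n R 2) fg0 (l1D hf hg).
apply: l1_le h => x; rewrite ger0_norm ?sqmod_ge0//; exact: sqmodD_le.
Qed.

Lemma ell2N f : ell2 f -> ell2 (- f).
Proof. by move=> hf; rewrite -scaleN1r; exact: ell2Z. Qed.

Lemma ell2B f g : ell2 f -> ell2 g -> ell2 (f - g).
Proof. by move=> hf /ell2N; exact: ell2D. Qed.

Lemma ell2_0 : ell2 (0 : V).
Proof. by rewrite /ell2/= esum1// => x _; rewrite sqmod0. Qed.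

Lemma ell2_sum (I : Type) (r : seq I) (P : pred I) (F : I -> V) :
  (forall i, P i -> ell2 (F i)) -> ell2 (\sum_(i <- r | P i) F i).
Proof.
move=> hF; elim/big_rec: _ => [|i x Pi hx]; first exact: ell2_0.
by apply: ell2D => //; exact: hF.
Qed.

Lemma ell2_dot f g : ell2 f -> ell2 g -> l1c (fun x => f x * (g x)^*).
Proof.
move=> /ell2_l1 hf /ell2_l1 hg; split; apply: l1_le (l1D hf hg) => x;
  case: (f x) (g x) => a b [p q]; rewrite /sqmod/= ler_norml.
  have := sqr_ge0 (a - p); have := sqr_ge0 (b - q).
  have := sqr_ge0 (a + p); have := sqr_ge0 (b + q).
  by rewrite !expr2; nra.
have := sqr_ge0 (a - q); have := sqr_ge0 (b - p).
have := sqr_ge0 (a + q); have := sqr_ge0 (b + p).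
by rewrite !expr2; nra.
Qed.

Lemma dotJ f g : dotl2 g f = (dotl2 f g)^*.
Proof.
by rewrite /dotl2 -csumJ; congr csum; apply: funext => x;
  rewrite conjcM conjCK mulrC.
Qed.

Lemma dotDl f g h : ell2 f -> ell2 g -> ell2 h ->
  dotl2 (f + g) h = dotl2 f h + dotl2 g h.
Proof.
move=> hf hg hh; rewrite /dotl2 -csumD; [|exact: ell2_dot|exact: ell2_dot].
by congr csum; apply: funext => x; rewrite /= -mulrDl.
Qed.

Lemma dotZl c f h : ell2 f -> ell2 h -> dotl2 (c *: f) h = c * dotl2 f h.
Proof.
move=> hf hh; rewrite /dotl2 -csumZ; last exact: ell2_dot.
by congr csum; apply: funext => x; rewrite mulrA.
Qed.

Lemma dotNl f h : ell2 f -> ell2 h -> dotl2 (- f) h = - dotl2 f h.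
Proof. by move=> hf hh; rewrite -scaleN1r dotZl// mulN1r. Qed.

Lemma dotBl f g h : ell2 f -> ell2 g -> ell2 h ->
  dotl2 (f - g) h = dotl2 f h - dotl2 g h.
Proof. by move=> hf hg hh; rewrite dotDl ?dotNl//; exact: ell2N. Qed.

Lemma dotDr f g h : ell2 f -> ell2 g -> ell2 h ->
  dotl2 h (f + g) = dotl2 h f + dotl2 h g.
Proof. by move=> hf hg hh; rewrite dotJ dotDl// conjcD -!dotJ. Qed.

Lemma dotZr c f h : ell2 f -> ell2 h -> dotl2 h (c *: f) = c^* * dotl2 h f.
Proof. by move=> hf hh; rewrite dotJ dotZl// conjcM -!dotJ. Qed.

Lemma dotBr f g h : ell2 f -> ell2 g -> ell2 h ->
  dotl2 h (f - g) = dotl2 h f - dotl2 h g.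
Proof. by move=> hf hg hh; rewrite dotJ dotBl// conjcB -!dotJ. Qed.

Lemma dot0l h : ell2 h -> dotl2 0 h = 0.
Proof. by move=> hh; rewrite -(scale0r (0 : V)) dotZl ?mul0r//; exact: ell2_0. Qed.

Lemma dot_suml (I : Type) (r : seq I) (P : pred I) (F : I -> V) h :
  (forall i, P i -> ell2 (F i)) -> ell2 h ->
  dotl2 (\sum_(i <- r | P i) F i) h = \sum_(i <- r | P i) dotl2 (F i) h.
Proof.
move=> hF hh; suff [] : ell2 (\sum_(i <- r | P i) F i) /\
   dotl2 (\sum_(i <- r | P i) F i) h = \sum_(i <- r | P i) dotl2 (F i) h by [].
elim/big_rec2: _ => [|i y x Pi [hx <-]]; first by split; [exact: ell2_0|exact: dot0l].
by split; [apply: ell2D => //; exact: hF|rewrite dotDl//; exact: hF].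
Qed.

Lemma dotff f : ell2 f -> dotl2 f f = (nsq f)%:C.
Proof.
move=> /ell2_l1 hf; rewrite /dotl2; apply: complex_eqP => /=.
  rewrite /nsq -rsum_ge0//; last by move=> x; exact: sqmod_ge0.
  by congr rsum; apply: funext => x; rewrite mulcJ.
rewrite (_ : (fun x => _) = (fun x => 0 * sqmod (f x))) ?(rsumZ 0 hf).2 ?mul0r//.
by apply: funext => x; rewrite mulcJ mul0r.
Qed.

Lemma normc_le_norml2 f x : ell2 f -> normc (f x) <= norml2 f.
Proof.
move=> hf; rewrite -(@ler_pXn2r _ 2)// ?nnegrE ?normc_ge0 ?norml2_ge0//.
rewrite sqr_norml2 -sqmodE.
have /ell2_l1 h := hf.
have := nnsum_lb (fun y => sqmod_ge0 (f y)) h (finite_set1 x).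
by rewrite fsbig_set1.
Qed.

Lemma nsq_eq0 f : ell2 f -> nsq f = 0 -> f = 0.
Proof.
move=> hf h0; apply: funext => x; apply: eq0_normc.
apply/le_anti; rewrite normc_ge0 andbT.
by have := normc_le_norml2 x hf; rewrite norml2E h0 sqrtr0.
Qed.

Lemma cauchy_schwarz f g : ell2 f -> ell2 g ->
  normc (dotl2 f g) <= norml2 f * norml2 g.
Proof.
move=> hf hg; rewrite -(@ler_pXn2r _ 2)// ?nnegrE ?normc_ge0 ?mulr_ge0 ?norml2_ge0//.
rewrite exprMn !sqr_norml2 -sqmodE; set d := dotl2 f g.
have [g0|g0] := eqVneq (nsq g) 0.
  by rewrite /d (nsq_eq0 hg g0) dotJ dot0l// conjC0 sqmod0 mulr_ge0 ?nsq_ge0.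
have gp : 0 < nsq g by rewrite lt_neqAle eq_sym g0 nsq_ge0.
(* Expanding <k, k> gives |g|^2 (|g|^2 |f|^2 - |<f, g>|^2), which is nonnegative. *)
pose k := (nsq g)%:C *: f - d *: g.
have hk : ell2 k by apply: ell2B; exact: ell2Z.
have hzf := ell2Z (nsq g)%:C hf; have hzg := ell2Z d hg.
have := nsq_ge0 k; rewrite -lecR -dotff// {1}/k dotBl// !dotZl// /k !dotBr// !dotZr//.
rewrite !dotff// -/d (dotJ f g) -/d.
have -> : (nsq g)%:C * ((nsq g)%:C^* * (nsq f)%:C - d^* * d) -
   d * ((nsq g)%:C^* * d^* - d^* * (nsq g)%:C)
   = (nsq g * (nsq g * nsq f - sqmod d))%:C.
  rewrite conjCr; have -> : d^* * d = (sqmod d)%:C by rewrite mulrC mulcJ.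
  by rewrite rmorphM rmorphB rmorphM/=; ring.
by rewrite lecR pmulr_rge0// subr_ge0 mulrC.
Qed.

Lemma norml2Z c f : ell2 f -> norml2 (c *: f) = normc c * norml2 f.
Proof.
move=> hf; rewrite !norml2E nsqZ// sqmodE sqrtrM ?sqr_ge0//.
by rewrite sqrtr_sqr ger0_norm// normc_ge0.
Qed.

Lemma norml2N f : norml2 (- f) = norml2 f.
Proof.
by rewrite /norml2; congr (Num.sqrt (fine _)); apply: eq_esum => x _; rewrite sqmodN.
Qed.

Lemma norml2D f g : ell2 f -> ell2 g -> norml2 (f + g) <= norml2 f + norml2 g.
Proof.
move=> hf hg; rewrite -(@ler_pXn2r _ 2)// ?nnegrE ?addr_ge0 ?norml2_ge0//.
rewrite sqr_norml2 -lecR -dotff; last exact: ell2D.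
rewrite dotDl// ?dotDr//; [|exact: ell2D..].
rewrite (dotJ f g) !dotff// -!sqr_norml2.
have := Re_le_normc (dotl2 f g); have := cauchy_schwarz hf hg.
case: (dotl2 f g) => a b /= h1 h2; rewrite lecE/=; apply/andP; split.
  by apply/eqP; ring.
by rewrite sqrrD; nra.
Qed.

Lemma norml2B_le f g h : ell2 f -> ell2 g -> ell2 h ->
  norml2 (f - h) <= norml2 (f - g) + norml2 (g - h).
Proof.
move=> hf hg hh; rewrite -[f - h](_ : (f - g) + (g - h) = _).
  by apply: norml2D; exact: ell2B.
by rewrite addrA subrK.
Qed.

Lemma dot_point (y : T) h : dotl2 (fun x => (x == y)%:R) h = (h y)^*.
Proof.
rewrite -[RHS](csum_point y); congr csum; apply: funext => x.
by case: eqP => [->|_]; rewrite ?mul1r ?mul0r.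
Qed.

Lemma ell2_point (y : T) : ell2 (fun x => (x == y)%:R : R[i]).
Proof.
apply/ell2_l1; have := (rsum_point y (1 : R)).1; congr l1; apply: funext => x.
by case: eqP => _; rewrite ?sqmod1 ?sqmod0.
Qed.

Definition restr (X : set T) h : V := fun x => if x \in X then h x else 0.

Lemma ell2_restr X h : ell2 h -> ell2 (restr X h).
Proof.
move=> hh; apply: (ell2_le _ hh).1 => x; rewrite /restr.
by case: ifP; rewrite ?lexx// sqmod0 sqmod_ge0.
Qed.

(** Allowing every larger truncation lets the finite set be replaced later by a ball of the tree. *)
Lemma restr_approx h e : ell2 h -> 0 < e -> exists2 X : set T, finite_set X &
  forall Y, X `<=` Y -> norml2 (h - restr Y h) < e.
Proof.
move=> /[dup] hh /ell2_l1 h1 e0.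
have e20 : 0 < e ^+ 2 by rewrite exprn_gt0.
have [X finX hX] := nnsum_approx (fun x => sqmod_ge0 (h x)) h1 e20.
exists X => // Y XY.
rewrite -(@ltr_pXn2r _ 2)// ?nnegrE ?norml2_ge0 ?(ltW e0)// sqr_norml2.
have hY := ell2_restr Y hh; have hB := ell2B hh hY.
have : nsq h = nsq (restr Y h) + nsq (h - restr Y h).
  rewrite /nsq -nnsumD.
  - congr nnsum; apply: funext => x; rewrite !fctE /restr.
    by case: ifP => _; rewrite ?subrr ?subr0 sqmod0 ?addr0 ?add0r.
  - by move=> x; exact: sqmod_ge0.
  - by move=> x; exact: sqmod_ge0.
  - exact/ell2_l1.
  - exact/ell2_l1.
have : \sum_(x \in X) sqmod (h x) <= nsq (restr Y h).
  have /ell2_l1 hY1 := hY.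
  apply: le_trans (nnsum_lb (fun x => sqmod_ge0 _) hY1 finX).
  rewrite le_eqVlt; apply/orP; left; apply/eqP.
  apply: eq_fsbigr => x /set_mem Xx; rewrite /restr mem_set//; exact: XY.
rewrite -/(nsq h) in hX; lra.
Qed.

End SquareSummable.

Lemma le_eps (R : realType) (a b c : R) : 0 <= c ->
  (forall e, 0 < e -> a <= b + e * c) -> a <= b.
Proof.
move=> c0 H; apply/ler_addgt0Pr => e e0.
have c1 : 0 < c + 1 by rewrite ltr_wpDl.
apply: (le_trans (H (e / (c + 1)) _)); first by rewrite divr_gt0.
by rewrite lerD2l mulrAC ler_pdivrMr// ler_pM2l// lerDl.
Qed.

(** * Closures of subspaces and a criterion for essential selfadjointness *)

Section Operators.
Variables (R : realType) (T : choiceType).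
Local Notation V := (T -> R[i]).
Implicit Types (f g h k : V) (S : set V) (w : R[i]).

Definition lin_closed S :=
  [/\ S `<=` ell2 (T:=T), S 0 & forall c f g, S f -> S g -> S (c *: f + g)].

(** The closure in l^2. Membership in [ell2] is demanded because [norml2] takes the default value 0
    on functions whose square sum is infinite. *)
Definition hull S : set V :=
  [set h | ell2 h /\ forall e : R, 0 < e -> exists2 g, S g & norml2 (h - g) < e].

Lemma norml2_0 : norml2 (0 : V) = 0.
Proof. by rewrite -(scale0r (0 : V)) norml2Z ?normc0 ?mul0r//; exact: ell2_0. Qed.

Lemma sub_hull S : S `<=` ell2 (T:=T) -> S `<=` hull S.
Proof.
move=> hS h Sh; split; first exact: hS.
by move=> e e0; exists h => //; rewrite subrr norml2_0.
Qed.

Lemma hull_hull S h : S `<=` ell2 (T:=T) -> ell2 h ->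
  (forall e : R, 0 < e -> exists2 g, hull S g & norml2 (h - g) < e) -> hull S h.
Proof.
move=> hS hh H; split => // e e0.
have e2 : 0 < e / 2 by rewrite divr_gt0.
have [g [hg Hg] lg] := H _ e2; have [k Sk lk] := Hg _ e2.
exists k => //; apply: (le_lt_trans (norml2B_le hh hg (hS _ Sk))); lra.
Qed.

Lemma hull_lin S : lin_closed S -> lin_closed (hull S).
Proof.
move=> [hS S0 SD]; split; [by move=> f []|exact: sub_hull|].
move=> c f g [hf Hf] [hg Hg]; split; first by apply: ell2D => //; exact: ell2Z.
move=> e e0; have n0 : 0 < normc c + 1 by rewrite ltr_wpDl ?normc_ge0.
have [|f' Sf' lf] := Hf (e / 2 / (normc c + 1)); first by rewrite !divr_gt0.
have [|g' Sg' lg] := Hg (e / 2); first by rewrite divr_gt0.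
exists (c *: f' + g'); first exact: SD.
have hf' := hS _ Sf'; have hg' := hS _ Sg'.
rewrite opprD addrACA -scalerBr.
have hB := ell2B hf hf'.
apply: (le_lt_trans (norml2D (ell2Z _ hB) (ell2B hg hg'))).
rewrite norml2Z//; move: lf; rewrite ltr_pdivlMr// => lf.
have := norml2_ge0 (f - f'); nra.
Qed.

Lemma lin_closed_sum S (I : Type) (r : seq I) (c : I -> R[i]) (F : I -> V) :
  lin_closed S -> (forall i, S (F i)) -> S (\sum_(i <- r) c i *: F i).
Proof.
move=> [_ S0 SD] SF; elim: r => [|i r IH]; first by rewrite big_nil.
by rewrite big_cons; exact: SD.
Qed.

Lemma restr_sum (X : set T) h : finite_set X ->
  restr X h = \sum_(y <- fset_set X) h y *: (fun x => (x == y)%:R : R[i]).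
Proof.
move=> finX; apply: funext => x; rewrite fct_sumE /restr.
transitivity (\sum_(y <- fset_set X) if y == x then h x else 0 : R[i]); last first.
  apply: eq_bigr => y _; rewrite /GRing.scale/= eq_sym; case: eqP => [->|_].
    exact/esym/mulr1.
  exact/esym/mulr0.
rewrite -big_mkcond/=; case: ifPn => xX.
  by rewrite -big_filter filter_pred1_uniq ?in_fset_set// ?fset_uniq// big_seq1.
by rewrite big_seq_cond big1// => y /andP[yX /eqP yx]; rewrite -yx -in_fset_set// yX in xX.
Qed.

Lemma hull_total S : lin_closed S ->
  (forall y : T, hull S (fun x => (x == y)%:R)) -> forall h, ell2 h -> hull S h.
Proof.
move=> LS HS h hh; apply: hull_hull => //; first by case: LS.
move=> e e0; have [X finX HX] := restr_approx hh e0.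
exists (restr X h); last exact: HX.
by rewrite restr_sum//; apply: lin_closed_sum => //; exact: hull_lin.
Qed.

Variable G : set (V * V).
Hypothesis G_ell2 : forall f g, G (f, g) -> ell2 f /\ ell2 g.
Hypothesis G_lin : forall c f g f' g', G (f, g) -> G (f', g') ->
  G (c *: f + f', c *: g + g').
Hypothesis G0 : G (0, 0).
Hypothesis G_sym : forall f g f' g', G (f, g) -> G (f', g') ->
  dotl2 g f' = dotl2 f g'.

Lemma shifted_range_lin w : lin_closed (shifted_range G w).
Proof.
split.
- by move=> _ [f [g [/G_ell2 [hf hg] ->]]]; apply: ell2B => //; exact: ell2Z.
- by exists 0, 0; rewrite scaler0 subr0.
- move=> c _ _ [f [g [Gf ->]]] [f' [g' [Gf' ->]]].
  exists (c *: f + f'), (c *: g + g'); split; first exact: G_lin.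
  by rewrite scalerBr scalerDr opprD addrACA !scalerA mulrC.
Qed.

(** Symmetry makes <g, f> real, so Im <g - w f, f> = - Im w |f|^2, and Cauchy-Schwarz bounds the
    left side. *)
Lemma symmetric_lower_bound w f g : G (f, g) ->
  `|complex.Im w| * norml2 f <= norml2 (g - w *: f).
Proof.
move=> Gfg; have [hf hg] := G_ell2 Gfg; have hwf := ell2Z w hf.
have [f0|f0] := eqVneq (norml2 f) 0; first by rewrite f0 mulr0 norml2_ge0.
have fp : 0 < norml2 f by rewrite lt_neqAle eq_sym f0 norml2_ge0.
rewrite -(ler_pM2r fp) -mulrA -expr2 sqr_norml2.
apply: le_trans (cauchy_schwarz (ell2B hg hwf) hf).
apply: le_trans (normc_Im _).
have E : complex.Im (dotl2 g f) = 0.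
  have := dotJ g f; rewrite -(G_sym Gfg Gfg); case: (dotl2 g f) => a b [].
  move=> /= ?; lra.
rewrite dotBl// dotZl// dotff// ImD E add0r.
have -> : complex.Im (- (w * (nsq f)%:C)) = - (complex.Im w * nsq f).
  by case: (w) => a b /=; ring.
by rewrite normrN normrM (ger0_norm (nsq_ge0 f)).
Qed.

(** For fixed (h, k) both sides of the adjoint relation are continuous in (f, g), so the relation
    survives limits of pairs from G. *)
Lemma adjoint_closure : adjoint (op_closure G) = adjoint G.
Proof.
apply/seteqP; split=> -[h k] [/= hh hk H]; split => //= f g.
  move=> Gfg; apply: H; have [? ?] := G_ell2 Gfg; split => //= e e0.
  by exists f, g; rewrite !subrr norml2_0.
move=> [/= hf hg Hc]; apply/eqP; rewrite -subr_eq0; apply/eqP/eq0_normc.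
apply/le_anti; rewrite normc_ge0 andbT.
apply: (@le_eps _ _ _ (norml2 h + norml2 k)).
  by rewrite addr_ge0 ?norml2_ge0.
move=> e e0; rewrite add0r; have [f' [g' [Gf lf lg]]] := Hc e e0.
have [hf' hg'] := G_ell2 Gf.
have -> : dotl2 g h - dotl2 f k = dotl2 (g - g') h + - dotl2 (f - f') k.
  by rewrite !dotBl// (H _ _ Gf); ring.
apply: (le_trans (le_normcD _ _)); rewrite normcN mulrDr; apply: lerD.
  apply: (le_trans (cauchy_schwarz (ell2B hg hg') hh)).
  by rewrite ler_wpM2r ?norml2_ge0// ltW.
apply: (le_trans (cauchy_schwarz (ell2B hf hf') hk)).
by rewrite ler_wpM2r ?norml2_ge0// ltW.
Qed.

Lemma closure_sub_adjoint : op_closure G `<=` adjoint G.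
Proof.
move=> [h k] /[dup] Hc [/= hh hk _]; split => //= f g Gfg.
have : adjoint (op_closure G) (f, g).
  rewrite adjoint_closure; have [? ?] := G_ell2 Gfg; split => //= f' g' Gf'.
  exact: G_sym.
by move=> [_ _ /(_ _ _ Hc) /= E]; rewrite dotJ [RHS]dotJ E.
Qed.

Lemma adjoint_lower_bound w h k : adjoint G (h, k) ->
  hull (shifted_range G w^*) h -> `|complex.Im w| * norml2 h <= norml2 (k - w *: h).
Proof.
move=> [/= hh hk H] [_ Hr].
have [h0|h0] := eqVneq (norml2 h) 0; first by rewrite h0 mulr0 norml2_ge0.
have hp : 0 < norml2 h by rewrite lt_neqAle eq_sym h0 norml2_ge0.
have hr := ell2B hk (ell2Z w hh); set r := norml2 (k - w *: h).
rewrite -(ler_pM2r hp) -mulrA -expr2.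
apply: (@le_eps _ _ _ (`|complex.Im w| * norml2 h + r)).
  by rewrite addr_ge0 ?mulr_ge0 ?norml2_ge0.
move=> e e0; have [_ [f [g [Gfg ->]]] lt] := Hr e e0.
have [hf hg] := G_ell2 Gfg; have hwf := ell2Z w^* hf.
have hgw := ell2B hg hwf.
have E : (nsq h)%:C = dotl2 (h - (g - w^* *: f)) h + dotl2 f (k - w *: h).
  rewrite dotBl// (dotBl hg hwf hh) dotBr//; last exact: ell2Z.
  by rewrite dotff// (H _ _ Gfg) dotZl// dotZr//; ring.
have := symmetric_lower_bound w^* Gfg; rewrite ImJ normrN => sb.
have b1 : norml2 (g - w^* *: f) <= norml2 h + e.
  rewrite -[X in norml2 X <= _](subKr h).
  apply: (le_trans (norml2D hh _)); first exact/ell2N/ell2B.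
  by rewrite norml2N lerD2l ltW.
have b2 : nsq h <= e * norml2 h + norml2 f * r.
  rewrite -[nsq h]ger0_norm ?nsq_ge0// -normcR E.
  apply: (le_trans (le_normcD _ _)); apply: lerD.
    apply: (le_trans (cauchy_schwarz (ell2B hh hgw) hh)).
    by rewrite ler_wpM2r ?norml2_ge0// ltW.
  exact: cauchy_schwarz.
have b3 : `|complex.Im w| * norml2 f <= norml2 h + e := le_trans sb b1.
have r0 : 0 <= r := norml2_ge0 _.
rewrite sqr_norml2.
apply: (le_trans (ler_wpM2l (normr_ge0 _) b2)).
rewrite mulrDr.
have := ler_wpM2r r0 b3; move: (normr_ge0 (complex.Im w)).
lra.
Qed.

(** For (h, k) in the adjoint, approximate k - w h by g - w f with (f, g) in G. The difference (h -
    f, k - g) is again in the adjoint, so the lower bound makes h - f small, and k - g is then small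
    as well. *)
Lemma essentially_selfadjoint_criterion w : complex.Im w != 0 ->
  (forall h, ell2 h -> hull (shifted_range G w) h) ->
  (forall h, ell2 h -> hull (shifted_range G w^*) h) ->
  essentially_selfadjoint G.
Proof.
move=> w0 D1 D2; rewrite /essentially_selfadjoint /selfadjoint adjoint_closure.
apply/seteqP; split; last exact: closure_sub_adjoint.
move=> [h k] /[dup] [[/= hh hk H]] Ha; split => //= e e0.
have hwh := ell2Z w hh; have hr := ell2B hk hwh.
have I0 : 0 < `|complex.Im w| by rewrite normr_gt0.
have n0 := normc_ge0 w.
(* Chosen so that e' + (1 + |w|) e' / |Im w| = e, which dominates the errors of both components. *)
pose e' := e / (1 + (1 + normc w) / `|complex.Im w|).
have den0 : 0 < 1 + (1 + normc w) / `|complex.Im w|.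
  by rewrite ltr_pwDl// divr_ge0// ?addr_ge0// ltW.
have e'0 : 0 < e' by rewrite divr_gt0.
have [_ [f [g [Gfg ->]]] lt] := (D1 _ hr).2 _ e'0.
have [hf hg] := G_ell2 Gfg; have hwf := ell2Z w hf.
have Ad : adjoint G (h - f, k - g).
  split => /=; [exact: ell2B|exact: ell2B|move=> f' g' Gf'].
  have [? ?] := G_ell2 Gf'.
  by rewrite !dotBr// (H _ _ Gf') (G_sym Gf' Gfg).
have E : k - g - w *: (h - f) = k - w *: h - (g - w *: f).
  by rewrite scalerBr !opprB addrACA [RHS]addrACA; congr (_ + _); rewrite addrC.
have := adjoint_lower_bound Ad (D2 _ (ell2B hh hf)); rewrite E => b1.
have b2 : norml2 (h - f) <= e' / `|complex.Im w|.
  by rewrite ler_pdivlMr// mulrC; apply: (le_trans b1); exact: ltW.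
have b3 : norml2 (k - g) <= norml2 (k - w *: h - (g - w *: f)) + normc w * norml2 (h - f).
  rewrite -E -norml2Z; last exact: ell2B.
  rewrite -[X in norml2 X <= _](subrK (w *: (h - f))).
  by apply: norml2D; [rewrite E; apply: ell2B => //; exact: ell2B|exact/ell2Z/ell2B].
have ee : e' * (1 + (1 + normc w) / `|complex.Im w|) = e.
  by rewrite divfK// gt_eqF.
have q0 : 0 < e' / `|complex.Im w| by rewrite divr_gt0.
have nq0 := mulr_ge0 n0 (ltW q0).
have ed : e = e' + e' / `|complex.Im w| + normc w * (e' / `|complex.Im w|).
  by rewrite -[LHS]ee; ring.
exists f, g; split => //; first by apply: (le_lt_trans b2); lra.
apply: (le_lt_trans b3); have := ler_wpM2l n0 b2; lra.
Qed.

End Operators.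

(** * The Jacobi operator as a symmetric matrix; its deficiency spaces as eigenspaces *)

Section TreeOperator.
Variables (R : realType) (d : nat) (lam beta : nat -> R).
Local Notation C := R[i].
Local Notation V := (vertex d -> C).
Local Notation dl := (@delta R d).
Local Notation Jd := (@Jdelta R d lam beta).
Local Notation J := (@Jop R d lam beta).
Local Notation G := (@Jacobi R d lam beta).
Implicit Types (x y : vertex d) (f g h u : V) (w : nat -> C).

(** Isolated from [Jdelta x] because it is the only part outside Gamma_x, and it is 0 at the
    root. *)
Definition pdelta x : V :=
  if x is _ :: x0 then (lam (size x0))%:C *: dl x0 else 0.

(** The formal Jacobi expression on arbitrary functions. The adjoint of J is its restriction to the
    l^2 functions with l^2 image. *)
Definition Jform h : V := fun x =>
  (if x is _ :: x0 then (lam (size x0))%:C * h x0 else 0)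
  + (beta (size x))%:C * h x + (lam (size x))%:C * \sum_(i < d) h (i :: x).

Lemma deltaE x y : dl x y = (y == x)%:R. Proof. by []. Qed.

(** Read as a function of y, the backward entry of x becomes the forward entry of y; this is the
    symmetry of the matrix. *)
Lemma pdeltaE x y : pdelta x y = (lam (size y))%:C * \sum_(i < d) (x == i :: y)%:R.
Proof.
case: x => [|j x] /=; first by rewrite big1 ?mulr0.
rewrite (bigD1 j)//= big1 ?addr0 => [|i ij]; last first.
  by rewrite eqseq_cons eq_sym (negbTE ij).
rewrite eqseq_cons eqxx eq_sym /=.
change ((lam (size x))%:C * (y == x)%:R = (lam (size y))%:C * (y == x)%:R :> C).
by case: eqP => [->//|_]; rewrite !mulr0.
Qed.

Lemma Jdelta_sum x y : Jd x y =
  pdelta x y + (beta (size x))%:C * (y == x)%:R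
  + (lam (size x))%:C * \sum_(i < d) (y == i :: x)%:R.
Proof. by rewrite /Jdelta -/(pdelta x) !fctE fct_sumE. Qed.

Lemma Jdelta_sym x y : Jd x y = Jd y x.
Proof.
rewrite !Jdelta_sum -!pdeltaE.
have -> : (beta (size x))%:C * (y == x)%:R = (beta (size y))%:C * (x == y)%:R :> C.
  by rewrite eq_sym; case: eqP => [->//|_]; rewrite !mulr0.
by ring.
Qed.

Lemma dot_delta x h : dotl2 (dl x) h = (h x)^*.
Proof. exact: dot_point. Qed.

Lemma ell2_delta x : ell2 (dl x).
Proof. exact: ell2_point. Qed.

Lemma ell2_pdelta x : ell2 (pdelta x).
Proof. by case: x => [|i x]; [exact: ell2_0|apply/ell2Z/ell2_delta]. Qed.

Lemma ell2_Jdelta x : ell2 (Jd x).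
Proof.
apply: ell2D; last by apply/ell2Z/ell2_sum => i _; exact: ell2_delta.
by apply: ell2D; [exact: ell2_pdelta|exact/ell2Z/ell2_delta].
Qed.

Lemma dot_pdelta x h : ell2 h ->
  dotl2 (pdelta x) h = (if x is _ :: x0 then (lam (size x0))%:C * h x0 else 0)^*.
Proof.
move=> hh; case: x => [|i x]; first by rewrite dot0l// conjC0.
by rewrite dotZl//; [rewrite dot_delta conjcM conjCr|exact: ell2_delta].
Qed.

Lemma dot_Jdelta x h : ell2 h -> dotl2 (Jd x) h = (Jform h x)^*.
Proof.
move=> hh; rewrite /Jdelta -/(pdelta x).
have hd y : ell2 (dl y) := ell2_delta y.
have hs : ell2 (\sum_(i < d) dl (i :: x)) by apply: ell2_sum.
have hp := ell2_pdelta x.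
rewrite dotDl//; [|by apply: ell2D => //; exact: ell2Z|exact: ell2Z].
rewrite dotDl//; last exact: ell2Z.
rewrite !dotZl// dot_suml// dot_pdelta// dot_delta /Jform !conjcD !conjcM !conjCr.
rewrite [in RHS]rmorph_sum; congr (_ + _ * _).
by apply: eq_bigr => i _; rewrite dot_delta.
Qed.

Lemma finsupp_sum f : finsupp f ->
  f = \sum_(y <- fset_set [set x | f x != 0]) f y *: dl y.
Proof.
move=> ff; rewrite -[LHS](_ : restr [set x | f x != 0] f = f).
  exact: restr_sum.
apply: funext => x; rewrite /restr; case: ifPn => //.
by rewrite notin_setE /= => /negP; rewrite negbK => /eqP.
Qed.

Lemma Jop_sum f : finsupp f ->
  J f = \sum_(y <- fset_set [set x | f x != 0]) f y *: Jd y.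
Proof. by move=> ff; rewrite /Jop fsbig_finite. Qed.

Lemma finsupp_ell2 f : finsupp f -> ell2 f /\ ell2 (J f).
Proof.
move=> ff; split.
  by rewrite (finsupp_sum ff); apply: ell2_sum => y _; exact/ell2Z/ell2_delta.
by rewrite Jop_sum//; apply: ell2_sum => y _; exact/ell2Z/ell2_Jdelta.
Qed.

Lemma Jop_Jform f : finsupp f -> J f = Jform f.
Proof.
move=> ff; apply: funext => x; have [hf _] := finsupp_ell2 ff.
rewrite -[RHS]conjCK -dot_Jdelta// [in RHS](finsupp_sum ff) dotJ conjCK.
rewrite dot_suml//; [|by move=> y _; exact/ell2Z/ell2_delta|exact: ell2_Jdelta].
rewrite Jop_sum// fct_sumE; apply: eq_bigr => y _.
rewrite dotZl; [|exact: ell2_delta|exact: ell2_Jdelta].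
rewrite dot_delta Jdelta_sym; congr (_ * _).
rewrite Jdelta_sum /pdelta; case: (y) => [|j y'] /=;
rewrite !conjcD !conjcM !conjCr rmorph_sum ?conjC0 /=; congr (_ + _ * _ + _ * _);
  rewrite ?rmorph_nat//; apply: eq_bigr => i _; rewrite rmorph_nat//.
Qed.

Lemma dot_Jop f h k : finsupp f -> ell2 h -> ell2 k -> Jform h = k ->
  dotl2 (J f) h = dotl2 f k.
Proof.
move=> ff hh + Ek; rewrite -Ek => hk; rewrite Jop_sum// [in RHS](finsupp_sum ff).
rewrite !dot_suml//; [|by move=> y _; exact/ell2Z/ell2_delta|by move=> y _; exact/ell2Z/ell2_Jdelta].
apply: eq_bigr => y _; rewrite !dotZl//; [|exact: ell2_delta|exact: ell2_Jdelta].
by rewrite dot_delta dot_Jdelta.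
Qed.

Lemma finsupp_delta x : finsupp (dl x).
Proof.
apply: (sub_finite_set _ (finite_set1 x)) => y /=.
by rewrite deltaE; case: (y =P x) => // _; rewrite eqxx.
Qed.

Lemma finsupp0 : finsupp (0 : V).
Proof. by apply: (sub_finite_set _ (finite_set0 _)) => y /=; rewrite eqxx. Qed.

Lemma finsupp_lin c f g : finsupp f -> finsupp g -> finsupp (c *: f + g).
Proof.
move=> ff fg; have fU : finite_set ([set x | f x != 0] `|` [set x | g x != 0]).
  by rewrite finite_setU.
apply: (sub_finite_set _ fU) => x /=.
have [f0|] := eqVneq (f x) 0; last by left.
have [g0|] := eqVneq (g x) 0; last by right.
by rewrite !fctE f0 g0 scaler0 addr0 eqxx.
Qed.

Lemma Jform_lin c f g : Jform (c *: f + g) = c *: Jform f + Jform g.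
Proof.
apply: funext => x; rewrite /Jform.
have E a : (c *: f + g) a = c * f a + g a by [].
rewrite E.
have -> : (c *: (fun x => (if x is _ :: x0 then (lam (size x0))%:C * f x0 else 0)
  + (beta (size x))%:C * f x + (lam (size x))%:C * \sum_(i < d) f (i :: x)) +
  (fun x => (if x is _ :: x0 then (lam (size x0))%:C * g x0 else 0)
  + (beta (size x))%:C * g x + (lam (size x))%:C * \sum_(i < d) g (i :: x))) x
  = c * ((if x is _ :: x0 then (lam (size x0))%:C * f x0 else 0)
  + (beta (size x))%:C * f x + (lam (size x))%:C * \sum_(i < d) f (i :: x)) +
  ((if x is _ :: x0 then (lam (size x0))%:C * g x0 else 0)
  + (beta (size x))%:C * g x + (lam (size x))%:C * \sum_(i < d) g (i :: x)) by [].
have -> : \sum_(i < d) (c *: f + g) (i :: x)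
   = c * (\sum_(i < d) f (i :: x)) + \sum_(i < d) g (i :: x).
  by rewrite mulr_sumr -big_split.
by case: x => [|j x]; rewrite ?E; ring.
Qed.

Lemma Jacobi_ell2 f g : G (f, g) -> ell2 f /\ ell2 g.
Proof. by move=> [/= ff ->]; exact: finsupp_ell2. Qed.

Lemma Jacobi_lin c f g f' g' : G (f, g) -> G (f', g') ->
  G (c *: f + f', c *: g + g').
Proof.
move=> [/= ff ->] [/= ff' ->]; split => /=; first exact: finsupp_lin.
by rewrite !Jop_Jform// ?Jform_lin//; exact: finsupp_lin.
Qed.

Lemma Jacobi0 : G (0, 0).
Proof.
split => /=; first exact: finsupp0.
rewrite Jop_Jform; last exact: finsupp0.
apply: funext => x; rewrite /Jform.
by rewrite big1// !mulr0 !addr0; case: x => [|j x]; rewrite ?mulr0.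
Qed.

Lemma Jacobi_sym f g f' g' : G (f, g) -> G (f', g') -> dotl2 g f' = dotl2 f g'.
Proof.
move=> [/= ff ->] [/= ff' ->]; have [h1 h2] := finsupp_ell2 ff'.
by apply: dot_Jop => //; rewrite Jop_Jform.
Qed.

Lemma deficiencyP z h : deficiency G z h <-> ell2 h /\ Jform h = z *: h.
Proof.
split=> -[hh H]; split => //.
  apply: funext => x; apply/eqP; rewrite -subr_eq0 -conjC_eq0; apply/eqP.
  have hx := ell2_delta x.
  have := H (J (dl x) - z^* *: dl x); rewrite dotBl//; [|by case: (finsupp_ell2 (finsupp_delta x))|exact: ell2Z].
  rewrite Jop_delta dot_Jdelta// dotZl// dot_delta conjcB => <-.
    by rewrite conjcM.
  exists (dl x), (Jd x); split => //; split => /=.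
    exact: finsupp_delta.
  by rewrite Jop_delta.
move=> _ [f [_ [[/= ff ->] ->]]]; have [hf hJf] := finsupp_ell2 ff.
rewrite dotBl//; last exact: ell2Z.
by rewrite (dot_Jop ff hh (ell2Z z hh) H) dotZl// dotZr// subrr.
Qed.

End TreeOperator.

(** * Functions on a subtree that depend on the level only *)

Section Fans.
Variables (R : realType) (d : nat) (lam beta : nat -> R).
Local Notation C := R[i].
Local Notation V := (vertex d -> C).
Local Notation dl := (@delta R d).
Local Notation Jform := (@Jform R d lam beta).
Local Notation pdelta := (@pdelta R d lam).
Implicit Types (x y : vertex d) (f g h u : V) (w : nat -> C).

Definition fan x w : V := fun y => if suffix x y then w (size y) else 0.

(** The index counts from the root and not from x, so the function is 0 for n < |x|. *)
Definition level x n : V := fan x (fun m => (m == n)%:R).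

(** The action of J on a function of |y| alone: the d children contribute equally, whence the factor
    d. *)
Definition radial w n : C :=
  (if n is n'.+1 then (lam n')%:C * w n' else 0) + (beta n)%:C * w n
  + d%:R * (lam n)%:C * w n.+1.

Lemma suffix_consE x i y : suffix x (i :: y) = (x == i :: y) || suffix x y.
Proof.
apply/idP/orP => [|[/eqP ->|h]]; [|exact: suffix_refl|]; last first.
  exact: (suffix_trans h (suffix_cons _ _)).
move=> /suffixP [[|j s] /= E]; first by left; rewrite E.
by right; case: E => _ ->; exact: suffix_suffix.
Qed.

Lemma suffix_size_eq x y : suffix x y -> size x = size y -> x = y.
Proof.
move=> /suffixP [s ->]; rewrite size_cat => /eqP.
by rewrite -[X in X == _]add0n eqn_add2r eq_sym size_eq0 => /eqP ->.
Qed.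

Lemma fan_ext x w w' : (forall n, (size x <= n)%N -> w n = w' n) ->
  fan x w = fan x w'.
Proof.
move=> E; apply: funext => y; rewrite /fan; case: ifP => // /size_suffix; exact: E.
Qed.

Lemma fan_delta x : fan x (fun m => (m == size x)%:R) = dl x.
Proof.
apply: funext => y; rewrite /fan deltaE; case: ifPn => s.
  case: eqP => [/esym/(suffix_size_eq s) ->|]; first by rewrite eqxx.
  by case: eqP => // ->.
by case: eqP => // E; rewrite E suffix_refl in s.
Qed.

(** Outside Gamma_x only the predecessor of x has a neighbour in the support, and it receives the
    leak. At x the fan is 0 on the predecessor, which agrees with [radial] because w vanishes below
    |x|. *)
Lemma Jform_fan x w : (forall n, (n < size x)%N -> w n = 0) ->
  Jform (fan x w) = fan x (radial w) + w (size x) *: pdelta x.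
Proof.
move=> w0; apply: funext => y.
have -> : (fan x (radial w) + w (size x) *: pdelta x) y
   = fan x (radial w) y + w (size x) * pdelta x y by [].
rewrite pdeltaE /Jform; case: (boolP (suffix x y)) => s.
  have -> : \sum_(i < d) (x == i :: y)%:R = 0 :> C.
    rewrite big1// => i _; case: eqP => // E; have := size_suffix s.
    by rewrite E /= ltnn.
  rewrite mulr0 mulr0 addr0 /fan s /radial.
  have -> : \sum_(i < d) (if suffix x (i :: y) then w (size (i :: y)) else 0)
     = d%:R * w (size y).+1.
    rewrite (eq_bigr (fun=> w (size y).+1)) => [|i _]; last by rewrite suffix_consE s orbT.
    by rewrite sumr_const card_ord mulr_natl.
  case: y s => [|j y] s /=; first by ring.
  have -> : (if suffix x y then w (size y) else 0) = w (size y).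
    case: ifPn => // ns; rewrite w0//.
    by move: s; rewrite suffix_consE (negbTE ns) orbF => /eqP ->.
  by ring.
have E1 : fan x (radial w) y = 0 by rewrite /fan (negbTE s).
have E2 : fan x w y = 0 by rewrite /fan (negbTE s).
rewrite E1 E2 mulr0 addr0 add0r.
have -> : (if y is _ :: x0 then (lam (size x0))%:C * fan x w x0 else 0) = 0.
  case: y s {E1 E2} => // j y; rewrite suffix_consE negb_or => /andP[_ ns].
  by rewrite /fan (negbTE ns) mulr0.
rewrite add0r mulrCA; congr (_ * _); rewrite mulr_sumr; apply: eq_bigr => i _.
rewrite /fan suffix_consE (negbTE s) orbF; case: eqP => [->|]; by rewrite ?mulr1 ?mulr0.
Qed.

Lemma count_level (s : seq (vertex d)) n : uniq s ->
  (count (fun y => size y == n) s <= d ^ n)%N.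
Proof.
move=> us; rewrite -size_filter.
rewrite -[X in (_ <= X ^ _)%N]card_ord -card_tuple cardE -(size_map val).
apply: uniq_leq_size; first exact: filter_uniq.
move=> y; rewrite mem_filter => /andP[/eqP sy _].
by apply/mapP; exists (tcast sy (in_tuple y)); rewrite ?mem_enum//= val_tcast.
Qed.

(** A finite set of vertices lies in a ball and meets level n in at most d^n points. *)
Lemma radial_ell2 f (a : nat -> R) (B : R) : (forall n, 0 <= a n) ->
  (forall y, sqmod (f y) <= a (size y)) ->
  (forall M, \sum_(n < M) (d ^ n)%:R * a n <= B) -> ell2 f /\ nsq f <= B.
Proof.
move=> a0 fa aB; rewrite ell2_l1; apply: nnsum_ub => [y|X finX].
  exact: sqmod_ge0.
rewrite fsbig_finite//; set s := fset_set X.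
pose M := (\max_(y <- s) size y).+1.
apply: le_trans (aB M).
apply: (@le_trans _ _ (\sum_(y <- s) \sum_(n < M) (size y == n)%:R * a n)).
  rewrite big_seq_cond [leRHS]big_seq_cond; apply: ler_sum => y /andP[ys _].
  have lt : (size y < M)%N.
    by rewrite ltnS (big_rem y)//= leq_maxl.
  rewrite (bigD1 (Ordinal lt))//= eqxx mul1r big1 ?addr0// => i ni.
  case: eqP => [E|_]; last by rewrite mul0r.
  by case/eqP: ni; apply: val_inj.
rewrite exchange_big/=; apply: ler_sum => n _.
rewrite -mulr_suml ler_wpM2r// -natr_sum ler_nat.
apply: leq_trans (count_level n (fset_uniq s)).
rewrite -sum1_count [leqRHS]big_mkcond/=; apply: leq_sum => y _.
by case: eqP.
Qed.

Lemma fan_ell2 x w B : (forall M, \sum_(n < M) (d ^ n)%:R * sqmod (w n) <= B) ->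
  ell2 (fan x w) /\ nsq (fan x w) <= B.
Proof.
apply: radial_ell2 (fun n => sqmod_ge0 (w n)) _ => y.
by rewrite /fan; case: ifP => _; rewrite ?lexx// sqmod0 sqmod_ge0.
Qed.

Lemma finite_ball n : finite_set [set y : vertex d | (size y <= n)%N].
Proof.
elim: n => [|n IH].
  by apply: (sub_finite_set _ (finite_set1 [::])) => y /=; rewrite leqn0 size_eq0 => /eqP.
have fU : finite_set ([set [::]] `|` \bigcup_(i in [set: 'I_d]) ((cons i) @` [set y : vertex d | (size y <= n)%N])).
  rewrite finite_setU; split; first exact: finite_set1.
  by apply: bigcup_finite => [|i _]; [exact: finite_finset|exact: finite_image].
apply: (sub_finite_set _ fU) => -[|i y] /=; first by left.
by rewrite ltnS => sy; right; exists i => //; exists y.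
Qed.

Lemma finite_set_ball (X : set (vertex d)) : finite_set X ->
  exists n, X `<=` [set y | (size y <= n)%N].
Proof.
move=> finX; exists (\max_(y <- fset_set X) size y)%N => y Xy /=.
by rewrite (big_rem y) ?leq_maxl//= in_fset_set// mem_set.
Qed.

Lemma finsupp_level x n : finsupp (level x n).
Proof.
apply: (sub_finite_set _ (finite_ball n)) => y /=; rewrite /level /fan.
case: ifP; last by rewrite eqxx.
by case: (size y =P n) => [->|]; rewrite ?leqnn// eqxx.
Qed.

Lemma level_lt x n : (n < size x)%N -> level x n = 0.
Proof.
move=> lt; apply: funext => y; rewrite /level /fan; case: ifP => // /size_suffix le.
by case: eqP => // E; move: lt; rewrite -E ltnNge le.
Qed.

Lemma sum_level x w n : \sum_(m < n) w m *: level x m =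
  fan x (fun m => if (m < n)%N then w m else 0).
Proof.
apply: funext => y; rewrite fct_sumE.
have E m : (w m *: level x m) y = w m * level x m y by [].
rewrite (eq_bigr (fun m : 'I_n => w m * level x m y)) => [|m _]; last exact: E.
rewrite /level /fan; case: (suffix x y); last first.
  by rewrite big1 => [|m _]; rewrite ?mulr0.
case: ifPn => sy.
  rewrite (bigD1 (Ordinal sy))//= eqxx mulr1 big1 ?addr0// => i ni.
  case: eqP => [Es|_]; last by rewrite mulr0.
  by case/eqP: ni; apply: val_inj.
rewrite big1// => i _; case: eqP => [Es|_]; last by rewrite mulr0.
by move: sy; rewrite Es ltn_ord.
Qed.

Lemma restr_fan x w n :
  restr [set y | (size y <= n)%N] (fan x w) = \sum_(m < n.+1) w m *: level x m.
Proof.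
rewrite sum_level; apply: funext => y; rewrite /restr /fan ltnS.
rewrite (_ : (y \in _) = (size y <= n)%N); first by do 2 case: ifP.
by apply/idP/idP => [/set_mem//|?]; exact/mem_set.
Qed.

(** Cut off at a ball, the fan is a finite combination of levels, and these truncations converge to
    it in l^2. *)
Lemma fan_orth x w u : ell2 (fan x w) -> ell2 u ->
  (forall n, dotl2 (level x n) u = 0) -> dotl2 (fan x w) u = 0.
Proof.
move=> hf hu H; apply: eq0_normc; apply/le_anti; rewrite normc_ge0 andbT.
apply: (le_eps (norml2_ge0 u)) => e e0; rewrite add0r.
have [X finX HX] := restr_approx hf e0; have [n Xn] := finite_set_ball finX.
have hr := ell2_restr [set y | (size y <= n)%N] hf.
have -> : dotl2 (fan x w) u = dotl2 (fan x w - restr [set y | (size y <= n)%N] (fan x w)) u.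
  rewrite dotBl// restr_fan dot_suml//.
    have hl m : ell2 (level x m) := (finsupp_ell2 lam beta (finsupp_level x m)).1.
    by rewrite big1 ?subr0// => m _; rewrite dotZl// H mulr0.
  by move=> m _; apply/ell2Z/(finsupp_ell2 lam beta (finsupp_level x m)).1.
apply: (le_trans (cauchy_schwarz (ell2B hf hr) hu)).
by rewrite ler_wpM2r ?norml2_ge0// ltW// HX.
Qed.

End Fans.

(** * Levels modulo the range of J - z *)

Section RangeDensity.
Variables (R : realType) (d : nat) (lam beta : nat -> R) (z : R[i]).
Hypothesis d_gt0 : (0 < d)%N.
Hypothesis lam_gt0 : forall n, 0 < lam n.
Local Notation C := R[i].
Local Notation V := (vertex d -> C).
Local Notation dl := (@delta R d).
Local Notation G := (@Jacobi R d lam beta).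
Local Notation Jform := (@Jform R d lam beta).
Local Notation pdelta := (@pdelta R d lam).
Local Notation vp := (@vpair R d lam beta z).
Local Notation lev := (@level R d).
Implicit Types (x y : vertex d) (f g h u : V) (w : nat -> C).

(* [vseq k n] takes the value 1, not 0, below [n = k]. *)
Definition vext k n : C :=
  if (n < k)%N then 0 else @vseq R d lam beta z k n.

Lemma scaleCE (a b : C) : a *: b = a * b.
Proof. by []. Qed.

Lemma lamC_neq0 n : (lam n)%:C != 0 :> C.
Proof. by rewrite (inj_eq (@complexI R)) gt_eqF. Qed.

Lemma dC_neq0 : d%:R != 0 :> C.
Proof. by rewrite pnatr_eq0 -lt0n. Qed.

Lemma fan_radial_level x n :
  fan x (radial d lam beta (fun m => (m == n)%:R)) =
  (lam n)%:C *: lev x n.+1 + (beta n)%:C *: lev x n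
  + (if n is n'.+1 then (d%:R * (lam n')%:C) *: lev x n' else 0).
Proof.
apply: funext => y; rewrite /fan.
have -> : ((lam n)%:C *: lev x n.+1 + (beta n)%:C *: lev x n
  + (if n is n'.+1 then (d%:R * (lam n')%:C) *: lev x n' else 0)) y
  = (lam n)%:C * lev x n.+1 y + (beta n)%:C * lev x n y
  + (if n is n'.+1 then (d%:R * (lam n')%:C) * lev x n' y else 0).
  by case: n.
rewrite /level /fan; case: ifP => s; last first.
  by rewrite !mulr0; case: n => [|n]; rewrite ?mulr0 !addr0.
have e1 : (if size y is n'.+1 then (lam n')%:C * (n' == n)%:R else 0)
   = (lam n)%:C * (size y == n.+1)%:R :> C.
  case: (size y) => [|m]; first by rewrite mulr0.
  by rewrite eqSS; case: eqP => [->//|_]; rewrite !mulr0.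
have e2 : (beta (size y))%:C * (size y == n)%:R = (beta n)%:C * (size y == n)%:R :> C.
  by case: eqP => [->//|_]; rewrite !mulr0.
have e3 : d%:R * (lam (size y))%:C * ((size y).+1 == n)%:R =
   (if n is n'.+1 then d%:R * (lam n')%:C * (size y == n')%:R else 0) :> C.
  case: n {e1 e2} => [|n]; first by rewrite mulr0.
  by rewrite eqSS; case: eqP => [->//|_]; rewrite !mulr0.
by rewrite /radial e1 e2 e3.
Qed.

Lemma level_range x n : (size x <= n)%N -> shifted_range G z
  ((lam n)%:C *: lev x n.+1 + (beta n)%:C *: lev x n
  + (if n is n'.+1 then (d%:R * (lam n')%:C) *: lev x n' else 0)
  + (size x == n)%:R *: pdelta x - z *: lev x n).
Proof.
move=> kn; exists (lev x n), (Jform (lev x n)); split.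
  have ff := @finsupp_level R d x n.
  by split => //=; rewrite Jop_Jform.
rewrite -fan_radial_level Jform_fan// => i ik.
by case: eqP => // E; rewrite -E leqNgt ik in kn.
Qed.

(** Write L_n for the levels below x. Modulo the range, lambda_n L_(n+1) = (z - beta_n) L_n - d
    lambda_(n-1) L_(n-1) for n > |x|, and the factor d^m turns this into the recurrence for v. For r
    existence suffices: the predecessor term is absorbed by induction from the root, or paired with
    a function vanishing there. *)
Lemma level_range_mod x m : exists r : C, shifted_range G z
  (lev x (size x + m)%N - ((d ^ m)%:R * (vp (size x) m).1) *: dl x
   - r *: pdelta x).
Proof.
set k := size x; set S := shifted_range G z.
have [hS S0 SD] : lin_closed S.
  apply: shifted_range_lin; [exact: Jacobi_ell2|exact: Jacobi_lin|exact: Jacobi0].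
pose P m := exists r, S (lev x (k + m)%N - ((d ^ m)%:R * (vp k m).1) *: dl x
   - r *: pdelta x).
(* The recurrence has order two, so the induction carries two consecutive generations. *)
suff [] : P m /\ P m.+1 by [].
have lnz := lamC_neq0; have dnz := dC_neq0.
elim: m => [|m [[r0 IH0] [r1 IH1]]].
  have L0 : lev x k = dl x by rewrite -fan_delta.
  split.
    exists 0; rewrite addn0 L0 /= mulr1 scale1r scale0r subrr subr0; exact: S0.
  (* From (J - z) delta_x = lambda_k L_(k+1) + (beta_k - z) delta_x + [pdelta x], divided by
     lambda_k. *)
  exists (- (lam k)%:C^-1); rewrite addn1.
  have := SD (lam k)%:C^-1 _ _ (level_range (leqnn k)) S0.
  congr S; apply: funext => y.
  have -> : (if k is n'.+1 then (d%:R * (lam n')%:C) *: lev x n' else 0) = 0.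
    rewrite /k; case E : (size x) => [//|n].
    by rewrite level_lt ?scaler0// E.
  have -> : (vp k 1).1 = (z - (beta k)%:C) / (d%:R * (lam k)%:C).
    by rewrite /= addn0 mulr1 mulr0 subr0.
  rewrite eqxx scale1r L0 !fctE !scaleCE expn1.
  by field; rewrite lnz dnz.
split; first by exists r1.
set n := (k + m.+1)%N.
have kn : (size x <= n)%N by rewrite /n leq_addr.
(* The predecessor coefficients follow the recurrence of the levels L_n themselves. *)
exists ((lam n)%:C^-1 * ((z - (beta n)%:C) * r1 - d%:R * (lam (k + m)%N)%:C * r0)).
have A1 := SD (lam n)%:C^-1 _ _ (level_range kn) S0.
have A2 := SD ((lam n)%:C^-1 * (z - (beta n)%:C)) _ _ IH1 A1.
have := SD (- ((lam n)%:C^-1 * (d%:R * (lam (k + m)%N)%:C))) _ _ IH0 A2.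
congr S; apply: funext => y.
have -> : (size x == n) = false by rewrite /n -addSnnS ltn_eqF// ltnS leq_addr.
have -> : (vp k m.+2).1 = ((z - (beta n)%:C) * (vp k m.+1).1
    - (lam (k + m)%N)%:C * (vp k m).1) / (d%:R * (lam n)%:C).
  by rewrite [LHS]/= -/n /n addnS.
rewrite scale0r [(k + m.+2)%N]addnS -/n.
have -> : (if n is n'.+1 then (d%:R * (lam n')%:C) *: lev x n' else 0)
  = (d%:R * (lam (k + m)%N)%:C) *: lev x (k + m)%N by rewrite /n addnS.
rewrite !fctE !scaleCE !natrX !exprS.
move: (lnz n) dnz => h1 h2.
by field; rewrite h1 h2.
Qed.

End RangeDensity.

(** * From failure of essential selfadjointness to one square summable solution *)

Section WeightedBound.
Variables (R : realType) (d : nat) (lam beta : nat -> R).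
Hypothesis d_gt0 : (0 < d)%N.
Hypothesis lam_gt0 : forall n, 0 < lam n.
Local Notation C := R[i].
Local Notation V := (vertex d -> C).
Local Notation dl := (@delta R d).
Local Notation G := (@Jacobi R d lam beta).
Local Notation pdelta := (@pdelta R d lam).
Local Notation lev := (@level R d).
Local Notation vx := (@vext R d lam beta).
Implicit Types (x y : vertex d) (u : V) (z : C).

(* Up to the factor [d ^ k], the squared norm of [fvec x] with [size x = k]. *)
Definition wsum z k M : R := \sum_(n < M) (d ^ n)%:R * sqmod (vx z k n).

Definition wbounded z k := exists B, forall M, wsum z k M <= B.

Lemma vextJ z k n : vx z^* k n = (vx z k n)^*.
Proof.
rewrite /vext; case: ifP => _; first by rewrite conjC0.
rewrite /vseq; suff -> m : vpair d lam beta z^* k m =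
   ((vpair d lam beta z k m).1^*, (vpair d lam beta z k m).2^*) by [].
elim: m => [|m IH]; first by rewrite /= conjC1 conjC0.
by rewrite /= IH /= !(rmorphM, rmorphB, fmorphV)/= !conjCr rmorph_nat.
Qed.

Lemma wsumJ z k M : wsum z^* k M = wsum z k M.
Proof. by apply: eq_bigr => n _; rewrite vextJ sqmodJ. Qed.

Lemma level_range_mod_vext z x n : exists r : C, shifted_range G z
  (lev x n - ((d ^ n)%:R / (d ^ size x)%:R * vx z (size x) n) *: dl x
   - r *: pdelta x).
Proof.
rewrite /vext; have [nk|kn] := ltnP n (size x).
  exists 0; rewrite level_lt// mulr0 !scale0r !subr0.
  by exists 0, 0; split; [exact: Jacobi0|rewrite scaler0 subr0].
have [r Hr] := level_range_mod beta z d_gt0 lam_gt0 x (n - size x).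
exists r; move: Hr; rewrite subnKC//; congr (shifted_range _ _ (_ - _ *: _ - _)).
rewrite /vseq; congr (_ * _); rewrite -[X in _ = (d ^ X)%:R / _](subnK kn) expnD natrM mulfK//.
by rewrite natrX expf_neq0// dC_neq0.
Qed.

Lemma hull_delta_step z x : ~ wbounded z (size x) ->
  hull (shifted_range G z) (pdelta x) -> hull (shifted_range G z) (dl x).
Proof.
move=> unb; set S := shifted_range G z => Hp.
have LS : lin_closed S.
  apply: shifted_range_lin; [exact: Jacobi_ell2|exact: Jacobi_lin|exact: Jacobi0].
have [hS S0 _] := LS; have [_ H0 HD] := hull_lin LS.
apply: hull_hull => //; first exact: ell2_delta.
move=> e e0; set k := size x; pose D : R := (d ^ k)%:R.
have D0 : 0 < D by rewrite ltr0n expn_gt0 d_gt0.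
(* Past this threshold the bound D^2 / W for the squared norm of the error falls below e^2. *)
have [M HM] : exists M, (D / e) ^+ 2 < wsum z k M.
  apply: contrapT => H; apply: unb; exists ((D / e) ^+ 2) => M.
  by rewrite leNgt; apply/negP => lt; apply: H; exists M.
set W := wsum z k M in HM.
have W0 : 0 < W by apply: le_lt_trans HM; exact: sqr_ge0.
have WC : W%:C != 0 :> C by rewrite (inj_eq (@complexI R)) gt_eqF.
have DC : (d ^ k)%:R != 0 :> C by rewrite natrX expf_neq0// dC_neq0.
pose q n : C := (d ^ n)%:R / (d ^ k)%:R * vx z k n.
(* Subject to sum c_n q_n = 1, coefficients proportional to conj(v_n) minimise sum d^n |c_n|^2, with
   minimum D^2 / W. *)
pose c n : C := (d ^ k)%:R * (vx z k n)^* / W%:C.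
have /choice[r Hr] : forall n, exists r : C,
  S (lev x n - q n *: dl x - r *: pdelta x) := level_range_mod_vext z x.
pose h := \sum_(n < M) c n *: lev x n.
pose a := \sum_(n < M) c n *: (lev x n - q n *: dl x - r n *: pdelta x).
have Sa : S a by apply: lin_closed_sum.
pose rr := \sum_(n < M) c n * r n.
have cq : \sum_(n < M) c n * q n = 1.
  transitivity ((\sum_(n < M) (d ^ n)%:R * (sqmod (vx z k n))%:C) / W%:C).
    rewrite mulr_suml; apply: eq_bigr => n _; rewrite /c /q -mulcJ.
    by field; rewrite WC DC.
  rewrite (_ : \sum_(n < M) _ = W%:C) ?divff//.
  by rewrite /W /wsum rmorph_sum; apply: eq_bigr => n _; rewrite rmorphM rmorph_nat.
have aE : a = h - dl x - rr *: pdelta x.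
  rewrite /a (eq_bigr (fun n : 'I_M => c n *: lev x n - (c n * q n) *: dl x
     - (c n * r n) *: pdelta x)) => [|n _].
    by rewrite !sumrB -!scaler_suml cq scale1r.
  by rewrite !scalerBr !scalerA.
exists (- 1 *: a + (- rr) *: pdelta x).
  apply: (HD); first exact: sub_hull.
  by rewrite -[X in hull S X]addr0; exact: HD.
have -> : dl x - (- 1 *: a + - rr *: pdelta x) = h.
  rewrite aE; clear; apply: funext => y; move: h => h.
  by rewrite !fctE !scaleCE; ring.
have [hh nh] : ell2 h /\ nsq h <= D ^+ 2 / W.
  rewrite /h sum_level; apply: fan_ell2 => N.
  (* The coefficients stop at M while [fan_ell2] asks for every N, so both sums are compared inside
     one of length max(N, M). *)
  apply: (@le_trans _ _ (\sum_(n < M) (d ^ n)%:R * sqmod (c n))).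
    have pos n : 0 <= (d ^ n)%:R * sqmod (c n) by rewrite mulr_ge0 ?sqmod_ge0.
    rewrite (eq_bigr (fun n : 'I_N => if (n < M)%N then (d ^ n)%:R * sqmod (c n) else 0)); last first.
      by move=> n _; case: ifP => //; rewrite sqmod0 mulr0.
    rewrite -big_mkcond/= (big_ord_widen_cond (maxn N M) (fun n => n < M)%N (fun n => (d ^ n)%:R * sqmod (c n)))/= ?leq_maxl//.
    rewrite [leRHS](big_ord_widen (maxn N M) (fun n => (d ^ n)%:R * sqmod (c n)))/= ?leq_maxr//.
    rewrite [leRHS](bigID (fun n : 'I_(maxn N M) => n < N)%N)/= lerDl.
    by apply: sumr_ge0.
  rewrite le_eqVlt; apply/orP; left; apply/eqP.
  transitivity (\sum_(n < M) D ^+ 2 / W ^+ 2 * ((d ^ n)%:R * sqmod (vx z k n))).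
    apply: eq_bigr => n _; rewrite /c !sqmodM sqmodJ.
    have -> : sqmod (d ^ k)%:R = D ^+ 2 :> R.
      by rewrite sqmodE -(rmorph_nat (real_complex R)) normcR ger0_norm.
    have -> : sqmod (W%:C)^-1 = W ^- 2.
      by rewrite sqmodE -fmorphV normcR ger0_norm ?invr_ge0 ?(ltW W0)// exprVn.
    by ring.
  by rewrite -mulr_sumr -/(wsum z k M) -/W; field; rewrite gt_eqF.
rewrite -(@ltr_pXn2r _ 2)// ?nnegrE ?norml2_ge0 ?(ltW e0)// sqr_norml2.
apply: (le_lt_trans nh); rewrite ltr_pdivrMr//.
by move: HM; rewrite expr_div_n ltr_pdivrMr ?exprn_gt0// mulrC.
Qed.

(** Induction along the path from the root, where the predecessor term is 0. *)
Lemma hull_delta z x : (forall k, ~ wbounded z k) ->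
  hull (shifted_range G z) (dl x).
Proof.
move=> unb.
have LS : lin_closed (shifted_range G z).
  apply: shifted_range_lin; [exact: Jacobi_ell2|exact: Jacobi_lin|exact: Jacobi0].
have [_ H0 HD] := hull_lin LS.
elim: x => [|j x IH]; apply: hull_delta_step => //.
by rewrite -[pdelta _]addr0; exact: HD.
Qed.

Lemma nesa_wbounded z : complex.Im z != 0 -> ~ essentially_selfadjoint G ->
  exists k, wbounded z k.
Proof.
move=> z0 nesa; apply: contrapT => H; apply: nesa.
have unb k : ~ wbounded z k by move=> Hk; apply: H; exists k.
have unbJ k : ~ wbounded z^* k.
  by move=> [B HB]; apply: (unb k); exists B => M; rewrite -wsumJ.
have LS w : lin_closed (shifted_range G w).
  apply: shifted_range_lin; [exact: Jacobi_ell2|exact: Jacobi_lin|exact: Jacobi0].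
apply: (essentially_selfadjoint_criterion (@Jacobi_ell2 R d lam beta)
  (@Jacobi_sym R d lam beta) z0).
- by apply: hull_total => // y; exact: hull_delta.
- by apply: hull_total => // y; exact: hull_delta.
Qed.

(** The range of J - z^* is orthogonal to u, and modulo it the level is a combination of delta_x and
    [pdelta x], both supported at zeros of u. At the root [behead x] is x itself and [pdelta x] is
    0. *)
Lemma level_orth z x u n : deficiency G z u -> u x = 0 -> u (behead x) = 0 ->
  dotl2 (lev x n) u = 0.
Proof.
move=> /[dup] /deficiencyP [hu _] [_ Hu] ux up.
have [r Hr] := level_range_mod_vext z^* x n.
have hp := ell2_pdelta lam x.
have hl : ell2 (lev x n) := (finsupp_ell2 lam beta (@finsupp_level R d x n)).1.
have hd := @ell2_delta R d x.
move: (Hu _ Hr); rewrite dotBl//; [|by apply: ell2B => //; exact: ell2Z|exact: ell2Z].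
rewrite dotBl//; last exact: ell2Z.
rewrite !dotZl// dot_delta ux dot_pdelta// conjC0 mulr0 subr0.
case: x up {ux Hr hp hl hd} => [|i x] /= up; first by rewrite conjC0 mulr0 subr0.
by rewrite up mulr0 conjC0 mulr0 subr0.
Qed.

End WeightedBound.

(** * Weyl circles: square summability for one starting index gives it for all *)

Section WeylAlternative.
Variables (R : realType) (d : nat) (lam beta : nat -> R) (z : R[i]).
Hypothesis d_gt0 : (0 < d)%N.
Hypothesis lam_gt0 : forall n, 0 < lam n.
Hypothesis z_nonreal : complex.Im z != 0.
Local Notation C := R[i].
Local Notation vx := (@vext R d lam beta z).
Local Notation ws := (@wsum R d lam beta z).
Local Notation wbounded := (@wbounded R d lam beta z).
Implicit Types (f g h : nat -> C) (t : C).

(** The recurrence is imposed at n + 1 for n >= k, so g k and g (k + 1) are free. The solutions from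
    k on form a plane, spanned by [vext k] and [vext k.+1]. *)
Definition solves k g := forall n, (k <= n)%N ->
  z * g n.+1 = (lam n)%:C * g n + (beta n.+1)%:C * g n.+1
               + d%:R * (lam n.+1)%:C * g n.+2.

(** With phi_n = d^(n/2) g_n this is sqrt(d) lambda_n Im(phi_(n+1) conj(phi_n)), the Wronskian of
    phi and its conjugate for the symmetrised recurrence, up to a constant. *)
Definition wronskian g n : R :=
  (d ^ n.+1)%:R * lam n * complex.Im (g n.+1 * (g n)^*).

Definition tailsum k g m : R :=
  \sum_(j < m) (d ^ (k + j))%:R * sqmod (g (k + j)%N).

Lemma dR_gt0 n : 0 < (d ^ n)%:R :> R.
Proof. by rewrite ltr0n expn_gt0 d_gt0. Qed.

Lemma natC_real n : n%:R = (n%:R : R)%:C.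
Proof. by rewrite rmorph_nat. Qed.

Lemma tailsumS k g m :
  tailsum k g m.+1 = tailsum k g m + (d ^ (k + m))%:R * sqmod (g (k + m)%N).
Proof. by rewrite /tailsum big_ord_recr. Qed.

Lemma tailsum_ge0 k g m : 0 <= tailsum k g m.
Proof. by apply: sumr_ge0 => j _; rewrite mulr_ge0 ?sqmod_ge0. Qed.

Lemma tailsum_term k g m j : (j < m)%N ->
  (d ^ (k + j))%:R * sqmod (g (k + j)%N) <= tailsum k g m.
Proof.
move=> jm; rewrite /tailsum (bigD1 (Ordinal jm))//= lerDl.
by apply: sumr_ge0 => i _; rewrite mulr_ge0 ?sqmod_ge0.
Qed.

Lemma tailsum_le k g m m' : (m <= m')%N -> tailsum k g m <= tailsum k g m'.
Proof.
move=> /subnKC <-; elim: (m' - m)%N => [|i IH]; first by rewrite addn0.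
by rewrite addnS tailsumS; apply: (le_trans IH); rewrite lerDl mulr_ge0 ?sqmod_ge0.
Qed.

Lemma tailsumD k f g h m : (forall n, h n = f n + g n) ->
  tailsum k h m <= 2 * (tailsum k f m + tailsum k g m).
Proof.
move=> E; rewrite /tailsum -big_split mulr_sumr; apply: ler_sum => j _.
by rewrite /= -mulrDr mulrCA ler_wpM2l// E sqmodD_le.
Qed.

Lemma tailsumZ k t g m : tailsum k (fun n => t * g n) m = sqmod t * tailsum k g m.
Proof.
by rewrite /tailsum mulr_sumr; apply: eq_bigr => j _; rewrite sqmodM mulrCA.
Qed.

Lemma wsum_tailsum k l m : (k <= l)%N ->
  ws l (k + m)%N = tailsum k (vx l) m.
Proof.
move=> kl; rewrite /wsum big_split_ord/= big1 ?add0r// => i _.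
by rewrite /vext (leq_trans (ltn_ord i) kl) sqmod0 mulr0.
Qed.

Lemma wboundedP k l : (k <= l)%N ->
  wbounded l <-> exists B, forall m, tailsum k (vx l) m <= B.
Proof.
move=> kl; split=> -[B HB]; exists B => M; first by rewrite -wsum_tailsum.
apply: le_trans (HB M); rewrite -wsum_tailsum// addnC /wsum big_split_ord/= lerDl.
by apply: sumr_ge0 => i _; rewrite mulr_ge0 ?sqmod_ge0.
Qed.

(** Multiply the recurrence at n + 1 by conj(g_(n+1)) and take imaginary parts; the real beta term
    drops out. *)
Lemma green_step k g n : solves k g -> (k <= n)%N ->
  complex.Im z * ((d ^ n.+1)%:R * sqmod (g n.+1)) =
  wronskian g n.+1 - wronskian g n.
Proof.
move=> /[apply]; rewrite natC_real /wronskian !natrX [_ ^+ n.+2]exprS.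
case: (g n) (g n.+1) (g n.+2) (z) => a b [p q] [r s] [u v] E.
have E1 := congr1 (@complex.Re R) E; have E2 := congr1 (@complex.Im R) E.
rewrite /= in E1 E2; rewrite /sqmod/=.
have F : v * (p ^+ 2 + q ^+ 2) = lam n * (b * p - a * q)
   + d%:R * lam n.+1 * (s * p - r * q).
  have -> : v * (p ^+ 2 + q ^+ 2) = (u * q + v * p) * p - (u * p - v * q) * q by ring.
  by rewrite E1 E2; ring.
rewrite mulrCA F; ring.
Qed.

Lemma green k g m : solves k g ->
  complex.Im z * tailsum k g m.+1 =
  wronskian g (k + m)%N - wronskian g k + complex.Im z * ((d ^ k)%:R * sqmod (g k)).
Proof.
move=> Sg; elim: m => [|m IH].
  by rewrite /tailsum big_ord1 addn0 subrr add0r.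
rewrite tailsumS mulrDr IH addnS (green_step Sg) ?leq_addr//; ring.
Qed.

(** Since [vext l] is 0 below l, the initial equation at l is an instance of the three-term
    recurrence. This admits l = k + 1. *)
Lemma vext_solves k l : (l <= k.+1)%N -> solves k (vx l).
Proof.
move=> lk n kn; have [_ V1 V2] := vseq_spec beta z d_gt0 lam_gt0 l.
have e1 : vx l n.+1 = vseq d lam beta z l n.+1.
  by rewrite /vext ltnNge (leq_trans lk).
have e2 : vx l n.+2 = vseq d lam beta z l n.+2.
  by rewrite /vext ltnNge (leq_trans lk)// ltnW.
have [ln|nl] := ltnP l n.+1.
  rewrite e1 e2 V2//=.
  by congr (_ + _ + _); rewrite /vext ltnNge -ltnS ln.
have E : l = n.+1 by apply/eqP; rewrite eqn_leq nl (leq_trans lk).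
by rewrite e1 e2 -E V1 {1}/vext E ltnSn mulr0 add0r -E.
Qed.

Lemma vext_id k : vx k k = 1.
Proof. by rewrite /vext ltnn /vseq subnn. Qed.

Lemma vext_lt k n : (n < k)%N -> vx k n = 0.
Proof. by rewrite /vext => ->. Qed.

(** This is the imaginary part of the initial equation; in [green] it cancels the term of index
    k. *)
Lemma wronskian_vext k : wronskian (vx k) k = complex.Im z * (d ^ k)%:R.
Proof.
have [_ V1 _] := vseq_spec beta z d_gt0 lam_gt0 k.
have e0 : vx k k = vseq d lam beta z k k by rewrite /vext ltnn.
have e1 : vx k k.+1 = vseq d lam beta z k k.+1 by rewrite /vext ltnNge leqnSn.
move: V1; rewrite -e0 -e1 vext_id natC_real /wronskian vext_id conjC1 !mulr1 => E.
have := congr1 (@complex.Im R) E; case: (vx k k.+1) => p q /= ->.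
by rewrite !natrX exprS; ring.
Qed.

(** By [green], Im z times the partial sum equals the Wronskian at k + m, which a zero would
    annihilate; but the sum contains d^k |v_k|^2 > 0. This permits the division defining t below. *)
Lemma vext_neq0 k m : vx k (k + m).+1 != 0.
Proof.
apply/eqP => E; have := green m (vext_solves (leqnSn k)).
rewrite wronskian_vext vext_id sqmod1 mulr1 subrK /wronskian E mul0r mulr0.
move/eqP; rewrite mulf_eq0 (negbTE z_nonreal)/=; apply/negP/lt0r_neq0.
apply: lt_le_trans (tailsum_term k (vx k) (ltn0Sn m)).
by rewrite addn0 vext_id sqmod1 mulr1 dR_gt0.
Qed.

(* For [P = vext k] and [T = vext k.+1], the solution [T - t P] vanishing at
   [k + m + 1] has no boundary term there, which puts [t] on a Weyl circle. *)
Lemma weyl_circle k m : exists t, complex.Im z *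
    tailsum k (fun n => vx k.+1 n - t * vx k n) m.+1 =
  - ((d ^ k.+1)%:R * lam k * complex.Im t).
Proof.
pose t := vx k.+1 (k + m).+1 / vx k (k + m).+1; exists t.
set g := fun n => _.
have Sg : solves k g.
  move=> n kn; rewrite /g.
  have := vext_solves (leqnn k.+1) kn; have := vext_solves (leqnSn k) kn.
  move: (vx k n) (vx k n.+1) (vx k n.+2) => p0 p1 p2 Ep Et.
  by rewrite mulrBr Et mulrCA Ep; ring.
rewrite (green m Sg).
have -> : wronskian g (k + m)%N = 0.
  by rewrite /wronskian /g /t divfK ?vext_neq0// subrr mul0r mulr0.
have W := wronskian_vext k; move: W; rewrite /wronskian /g vext_id conjC1 !mulr1.
rewrite (vext_lt (ltnSn k)) vext_id => W.
rewrite !sub0r sqmodN [complex.Im z * (_ * _)]mulrA -W.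
by clear; move: (vx k k.+1) t => [p q] [a b]; rewrite /sqmod/=; ring.
Qed.

(** The circle equation gives S <= a |t| for the partial sum S. As T_k = 0 and P_k = 1, the first
    term of S is d^k |t|^2, so |t| <= a / d^k = B, and then S <= a B = K for every m. *)
Lemma weyl_bound k : exists K B : R, [/\ 0 <= B, 0 <= K & forall m, exists t,
  [/\ normc t <= B,
      tailsum k (fun n => vx k.+1 n - t * vx k n) m.+1 <= K &
      tailsum k (fun n => vx k.+1 n - t * vx k n) m.+1 <=
        (d ^ k.+1)%:R * lam k / `|complex.Im z| * normc t]].
Proof.
set a := (d ^ k.+1)%:R * lam k / `|complex.Im z|.
have I0 : 0 < `|complex.Im z| by rewrite normr_gt0.
have a0 : 0 < a by rewrite divr_gt0// mulr_gt0 ?dR_gt0.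
pose B := a / (d ^ k)%:R.
have B0 : 0 <= B by rewrite divr_ge0// ltW.
exists (a * B), B; split => //; first by rewrite mulr_ge0// ltW.
move=> m; have [t Ht] := weyl_circle k m; exists t.
set S := tailsum _ _ _ in Ht *.
have HS : S <= a * normc t.
  rewrite /a mulrAC ler_pdivlMr//.
  have -> : S * `|complex.Im z| = `|(d ^ k.+1)%:R * lam k * complex.Im t|.
    by rewrite -[RHS]normrN -Ht normrM mulrC (ger0_norm (tailsum_ge0 _ _ _)).
  rewrite normrM ger0_norm ?ler_wpM2l ?normc_Im//; by rewrite mulr_ge0// ltW.
have : (d ^ k)%:R * sqmod t <= S.
  have := tailsum_term k (fun n => vx k.+1 n - t * vx k n) (ltn0Sn m).
  by rewrite addn0 (vext_lt (ltnSn k)) vext_id sub0r mulr1 sqmodN.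
rewrite sqmodE => Ht2; have n0 := normc_ge0 t.
have tB : normc t <= B.
  have [t0|t0] := eqVneq (normc t) 0; first by rewrite t0.
  have tp : 0 < normc t by rewrite lt_neqAle eq_sym t0.
  rewrite /B ler_pdivlMr ?dR_gt0// -(ler_pM2r tp) mulrAC -expr2 mulrC.
  exact: le_trans HS.
by split => //; apply: (le_trans HS); rewrite ler_pM2l.
Qed.

(** Write T = (T - t P) + t P: here t changes with m, but its bound does not. *)
Lemma wboundedS k : wbounded k -> wbounded k.+1.
Proof.
move=> /(wboundedP (leqnn k)) [Bp Hp]; apply/(wboundedP (leqnSn k)).
have [K [B [B0 K0 H]]] := weyl_bound k.
exists (2 * (K + B ^+ 2 * Bp)) => m.
apply: le_trans (tailsum_le k _ (leqnSn m)) _.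
have [t [tB HK _]] := H m.
have E n : vx k.+1 n = (vx k.+1 n - t * vx k n) + t * vx k n.
  by rewrite subrK.
apply: (le_trans (tailsumD k m.+1 E)); rewrite ler_wpM2l//; apply: lerD => //.
rewrite tailsumZ sqmodE ler_pM ?sqr_ge0 ?tailsum_ge0//.
by rewrite ler_pXn2r// nnegrE// normc_ge0.
Qed.

(** Here t P = T - (T - t P) has to be divided by t, so |t| must stay away from 0. This follows at
    index k + 1: T_(k+1) = 1, while |T - t P|^2 and |t P|^2 there are at most constant multiples of
    |t|. *)
Lemma wbounded_pred k : wbounded k.+1 -> wbounded k.
Proof.
move=> /(wboundedP (leqnSn k)) [Bt Ht]; apply/(wboundedP (leqnn k)).
have [K [B [B0 K0 H]]] := weyl_bound k.
set a := (d ^ k.+1)%:R * lam k / `|complex.Im z| in H.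
have I0 : 0 < `|complex.Im z| by rewrite normr_gt0.
have a0 : 0 < a by rewrite divr_gt0// mulr_gt0 ?dR_gt0.
pose Q := 2 * (a / (d ^ k.+1)%:R + B * sqmod (vx k k.+1)).
have Q0 : 0 < Q.
  have : 0 < a / (d ^ k.+1)%:R by rewrite divr_gt0 ?dR_gt0.
  have : 0 <= B * sqmod (vx k k.+1) by rewrite mulr_ge0 ?sqmod_ge0.
  by rewrite /Q; lra.
exists (2 * (Bt + K) * Q ^+ 2) => m.
apply: le_trans (tailsum_le k _ (leqW (leqnSn m))) _.
(* The shift ensures that the partial sum, of m + 2 terms, contains index k + 1. *)
have [t [tB HK Ha]] := H m.+1; have n0 := normc_ge0 t.
set g := fun n => vx k.+1 n - t * vx k n in HK Ha.
have tQ : 1 <= normc t * Q.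
  have H1 : sqmod (g k.+1) <= a / (d ^ k.+1)%:R * normc t.
    rewrite mulrAC ler_pdivlMr ?dR_gt0// mulrC; apply: le_trans Ha.
    by have := tailsum_term k g (ltn_ord (lift ord0 (@ord0 m))); rewrite /= addn1.
  have H2 : sqmod (t * vx k k.+1) <= B * sqmod (vx k k.+1) * normc t.
    have tt : normc t ^+ 2 <= B * normc t by rewrite expr2 ler_wpM2r.
    have := ler_wpM2r (sqmod_ge0 (vx k k.+1)) tt.
    by rewrite sqmodM [sqmod t]sqmodE [X in _ <= X -> _]mulrAC.
  have := sqmodD_le (g k.+1) (t * vx k k.+1).
  rewrite {1}/g subrK vext_id sqmod1 => H3; apply: (le_trans H3).
  rewrite /Q; nra.
have E n : t * vx k n = vx k.+1 n + - 1 * g n by rewrite /g; ring.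
have := tailsumD k m.+2 E; rewrite !tailsumZ sqmodN sqmod1 mul1r => H4.
have H5 : sqmod t * tailsum k (vx k) m.+2 <= 2 * (Bt + K).
  by apply: (le_trans H4); rewrite ler_wpM2l// lerD.
have Q1 : 1 <= sqmod t * Q ^+ 2 by rewrite sqmodE -exprMn exprn_ege1.
have T0 := tailsum_ge0 k (vx k) m.+2.
rewrite -[leLHS]mul1r.
apply: (le_trans (ler_wpM2r T0 Q1)).
by rewrite mulrAC ler_wpM2r// sqr_ge0.
Qed.

Lemma wbounded_all k l : wbounded k -> wbounded l.
Proof.
move=> Hk; have H0 : wbounded 0.
  by elim: k Hk => // k IH /wbounded_pred /IH.
by elim: l => // l; exact: wboundedS.
Qed.

End WeylAlternative.

(** * Linear spans and algebraic sums *)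

Section LinearSpan.
Variables (R : realType) (T : choiceType).
Local Notation V := (T -> R[i]).
Implicit Types (S : set V) (g h : V).

Lemma lspan0 S : lspan S 0.
Proof. by exists 0, (fun=> 0), (fun=> 0); split; [case|rewrite big_ord0]. Qed.

Lemma sub_lspan S : S `<=` lspan S.
Proof.
by move=> h Sh; exists 1, (fun=> 1), (fun=> h); split => //;
  rewrite big_ord1 scale1r.
Qed.

Lemma lspan_lin S k h h' : lspan S h -> lspan S h' -> lspan S (k *: h + h').
Proof.
move=> [n [c [u [Su ->]]]] [n' [c' [u' [Su' ->]]]].
exists (n + n')%N, (fun i => match fintype.split i with inl j => k * c j | inr j => c' j end).
exists (fun i => match fintype.split i with inl j => u j | inr j => u' j end); split.
  by move=> i; case: (fintype.split i).
rewrite big_split_ord/= scaler_sumr; congr (_ + _); apply: eq_bigr => i _.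
  by rewrite (unsplitK (inl i)) scalerA.
by rewrite (unsplitK (inr i)).
Qed.

Lemma lspan_sum S (I : eqType) (r : seq I) (F : I -> V) :
  (forall i, i \in r -> lspan S (F i)) -> lspan S (\sum_(i <- r) F i).
Proof.
elim: r => [|i r IH] H; first by rewrite big_nil; exact: lspan0.
rewrite big_cons -[F i]scale1r; apply: lspan_lin; first exact/H/mem_head.
by apply: IH => j jr; apply: H; rewrite in_cons jr orbT.
Qed.

Lemma lspan_le S S' : S `<=` S' -> S' 0 ->
  (forall k g h, S' g -> S' h -> S' (k *: g + h)) -> lspan S `<=` S'.
Proof.
move=> SS S0 SD h [n [c [u [Su ->]]]].
elim: n c u Su => [|n IH] c u Su; first by rewrite big_ord0.
rewrite big_ord_recr/= addrC; apply: SD; first exact/SS/Su.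
by apply: IH => i; exact: Su.
Qed.

(** Each vector of a combination is assigned one index, and the terms with equal index are added
    within the corresponding space. *)
Lemma algsum_lspan (I : choiceType) (A : I -> set V) :
  (forall x, A x 0) -> (forall x k g h, A x g -> A x h -> A x (k *: g + h)) ->
  algsum A = lspan (\bigcup_x A x).
Proof.
move=> A0 AD; apply/seteqP; split=> h.
  move=> [D [g [finD Ag ->]]]; rewrite fsbig_finite//.
  apply: lspan_sum => x xD; apply: sub_lspan; exists x => //.
  by apply: Ag; move: xD; rewrite in_fset_set// => /set_mem.
move=> [n [c [u [Su ->]]]].
have /choice[x_ Hx] : forall i, exists x, A x (u i).
  by move=> i; have [x _ ?] := Su i; exists x.
pose D : set I := x_ @` [set: 'I_n].
have finD : finite_set D by apply: finite_image; exact: finite_finset.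
exists D, (fun x => \sum_(i | x_ i == x) c i *: u i); split => //.
  move=> x _; elim/big_ind: _ => //.
    by move=> g g' ? ?; rewrite -[g]scale1r; exact: AD.
  by move=> i /eqP <-; rewrite -[_ *: _]addr0; exact: AD.
rewrite fsbig_finite// (exchange_big_dep xpredT)//=; apply: eq_bigr => i _.
rewrite -big_filter (eq_filter (a2 := pred1 (x_ i))); last by move=> x; rewrite /= eq_sym.
rewrite filter_pred1_uniq ?fset_uniq ?big_seq1// in_fset_set// mem_set//.
by exists i.
Qed.

End LinearSpan.

(** * The spaces A_x inside the deficiency space: orthogonality and density *)

Section DeficiencySpace.
Variables (R : realType) (d : nat) (lam beta : nat -> R) (z : R[i]).
Hypothesis d_gt0 : (0 < d)%N.
Hypothesis lam_gt0 : forall n, 0 < lam n.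
Hypothesis z_nonreal : complex.Im z != 0.
Hypothesis nesa : ~ essentially_selfadjoint (@Jacobi R d lam beta).
Local Notation C := R[i].
Local Notation V := (vertex d -> C).
Local Notation G := (@Jacobi R d lam beta).
Local Notation N := (deficiency G z).
Local Notation A := (@Aspace R d lam beta z).
Local Notation Jf := (@Jform R d lam beta).
Local Notation pdelta := (@pdelta R d lam).
Local Notation fvec := (@fvec R d lam beta z).
Local Notation vx := (@vext R d lam beta z).
Implicit Types (x y : vertex d) (g h u : V).

Lemma fvecE x : fvec x = fan x (vx (size x)).
Proof.
apply: fan_ext => n kn; by rewrite /vext ltnNge kn.
Qed.

Lemma ell2_fvec x : ell2 (fvec x).
Proof.
have [k Hk] := nesa_wbounded d_gt0 lam_gt0 z_nonreal nesa.
have [B HB] := wbounded_all d_gt0 lam_gt0 z_nonreal (size x) Hk.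
by rewrite fvecE; exact: (fan_ell2 x HB).1.
Qed.

(** The recurrence for v is the eigenvalue equation inside Gamma_x, so only the leak of the fan,
    with v_k = 1, remains. *)
Lemma Jform_fvec x : Jf (fvec x) = z *: fvec x + pdelta x.
Proof.
rewrite {1}fvecE Jform_fan => [|n nk]; last exact: vext_lt.
rewrite vext_id scale1r; congr (_ + _).
have -> : z *: fvec x = fan x (fun n => z * vx (size x) n).
  by apply: funext => y; rewrite fvecE fctE scaleCE /fan; case: ifP; rewrite ?mulr0.
apply: fan_ext => n kn; have [_ V1 V2] := vseq_spec beta z d_gt0 lam_gt0 (size x).
have e0 : vx (size x) n = vseq d lam beta z (size x) n.
  by rewrite /vext ltnNge kn.
have e1 : vx (size x) n.+1 = vseq d lam beta z (size x) n.+1.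
  by rewrite /vext ltnNge leqW.
move: kn; rewrite leq_eqVlt => /orP[/eqP E|kn].
  rewrite /radial e0 e1 -E V1; case E' : (size x) => [|k]; first by rewrite add0r.
  by rewrite vext_lt// mulr0 add0r.
by case: n kn e0 e1 => // n kn e0 e1; rewrite (vext_solves beta z d_gt0 lam_gt0 (ltnW kn) (leqnn n)).
Qed.

Lemma Jform0 : Jf 0 = 0.
Proof.
have := Jform_lin lam beta (-1) 0 (0 : V).
by rewrite scaler0 addr0 scaleN1r addNr.
Qed.

Lemma deficiency_lin k g h : N g -> N h -> N (k *: g + h).
Proof.
move=> /deficiencyP [hg Eg] /deficiencyP [hh Eh]; apply/deficiencyP; split.
  by apply: ell2D => //; exact: ell2Z.
by rewrite Jform_lin Eg Eh scalerDr !scalerA mulrC.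
Qed.

Lemma deficiency0 : N 0.
Proof. by apply/deficiencyP; rewrite Jform0 scaler0; split => //; exact: ell2_0. Qed.

Lemma Aspace0 (x : option (vertex d)) : A x 0.
Proof.
case: x => [x|]; last by exists 0; rewrite scale0r.
by exists (fun=> 0); split; rewrite big1// => i _; rewrite scale0r.
Qed.

Lemma Aspace_lin (x : option (vertex d)) k g h : A x g -> A x h -> A x (k *: g + h).
Proof.
case: x => [x|] [a Ha] [b Hb]; last first.
  by exists (k * a + b); rewrite Ha Hb scalerA scalerDl.
case: Ha Hb => [a0 ->] [b0 ->]; exists (fun i => k * a i + b i); split.
  by rewrite big_split/= -mulr_sumr a0 b0 mulr0 addr0.
by rewrite scaler_sumr -big_split; apply: eq_bigr => i _; rewrite scalerDl scalerA.
Qed.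

Lemma Jform_sum (a : 'I_d -> C) (F : 'I_d -> V) :
  Jf (\sum_(i < d) a i *: F i) = \sum_(i < d) a i *: Jf (F i).
Proof.
elim/big_rec2: _ => [|i g h _ <-]; first exact: Jform0.
exact: Jform_lin.
Qed.

(** Siblings have the same [pdelta], so the leaks add up to a multiple of the sum of the a_i. At the
    root there is no leak. *)
Lemma Aspace_deficiency (x : option (vertex d)) : A x `<=` N.
Proof.
move=> h; case: x => [x|] [a]; last first.
  move=> ->; rewrite -[_ *: _]addr0; apply: deficiency_lin; last exact: deficiency0.
  apply/deficiencyP; split; first exact: ell2_fvec.
  by rewrite Jform_fvec addr0.
move=> [a0 ->]; apply/deficiencyP; split.
  by apply: ell2_sum => i _; exact/ell2Z/ell2_fvec.
rewrite Jform_sum scaler_sumr.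
rewrite (eq_bigr (fun i => z *: (a i *: fvec (i :: x)) + a i *: pdelta (i :: x))).
  by rewrite big_split/= -scaler_suml a0 scale0r addr0.
by move=> i _; rewrite Jform_fvec scalerDr !scalerA mulrC.
Qed.

Lemma Aspace_support y u x : A (Some y) u ->
  (forall i, ~~ suffix (i :: y) x) -> u x = 0.
Proof.
move=> [a [_ ->]] H; rewrite fct_sumE big1// => i _.
by rewrite fctE /Defs.fvec (negbTE (H i)) scaler0.
Qed.

Lemma fvec_orth x u : N u -> u x = 0 -> u (behead x) = 0 -> dotl2 (fvec x) u = 0.
Proof.
move=> Nu ux up; have [hu _] := Nu; have := ell2_fvec x; rewrite fvecE => hf.
apply: (fan_orth lam beta hf hu) => n.
exact: (level_orth d_gt0 lam_gt0 n Nu ux up).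
Qed.

(** Elements of A_y live strictly below y. When y is at least as deep as x and differs from it, they
    vanish at x and at all its children, so [fvec_orth] applies to each f_(x_i). *)
Lemma Aspace_orth_le (x : option (vertex d)) y g h : x != Some y ->
  (if x is Some x' then (size x' <= size y)%N else true) ->
  A x g -> A (Some y) h -> dotl2 g h = 0.
Proof.
move=> xy; have Nh u : A (Some y) u -> N u by apply: Aspace_deficiency.
case: x xy => [x|] xy sxy [a]; last first.
  move=> -> Ah; have [hh _] := Nh _ Ah; rewrite dotZl//; last exact: ell2_fvec.
  rewrite fvec_orth ?mulr0//; [exact: Nh| |];
    by apply: (Aspace_support Ah) => i; apply/negP => /size_suffix.
move=> [_ ->] Ah; have [hh _] := Nh _ Ah.
rewrite dot_suml//; last by move=> i _; exact/ell2Z/ell2_fvec.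
rewrite big1// => i _; rewrite dotZl//; last exact: ell2_fvec.
rewrite fvec_orth ?mulr0//; first exact: Nh.
  apply: (Aspace_support Ah) => j; apply/negP => s.
  have /= := size_suffix s; rewrite ltnS => yx.
  have /(suffix_size_eq s) [_ E] : size (j :: y) = size (i :: x).
    by congr _.+1; apply/eqP; rewrite eqn_leq yx.
  by move: xy; rewrite E eqxx.
apply: (Aspace_support Ah) => j; apply/negP => /size_suffix /=.
by rewrite ltnNge sxy.
Qed.

Lemma Aspace_orthogonal : orthogonal_family A.
Proof.
move=> x y xy g h Ag Ah.
have dotC : dotl2 h g = 0 -> dotl2 g h = 0 by move=> E; rewrite dotJ E conjC0.
have yx : y != x by rewrite eq_sym.
case: x y xy yx Ag Ah => [x|] [y|] xy yx Ag Ah //.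
- have [le|lt] := leqP (size x) (size y).
    exact: (Aspace_orth_le xy le Ag Ah).
  exact/dotC/(Aspace_orth_le yx (ltnW lt) Ah Ag).
- exact/dotC/(Aspace_orth_le yx isT Ah Ag).
- exact: (Aspace_orth_le xy isT Ag Ah).
Qed.

Lemma Aspace_direct : direct_family A.
Proof.
move=> D g finD Ag; rewrite fsbig_finite// => E x Dx.
have hA o : o \in fset_set D -> A o (g o).
  by rewrite in_fset_set// => /set_mem; exact: Ag.
have hx : ell2 (g x) by case: (Aspace_deficiency (Ag _ Dx)).
apply: nsq_eq0 => //.
suff Z : dotl2 (g x) (g x) = 0 by move: (dotff hx); rewrite Z => -[].
rewrite -(dot0l hx) -E [in RHS]big_seq_cond dot_suml//; last first.
  by move=> y; rewrite andbT => /hA /Aspace_deficiency [].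
rewrite -big_seq_cond (bigD1_seq x) ?fset_uniq ?in_fset_set ?mem_set//=.
rewrite big_seq_cond big1 ?addr0// => y /andP[yD yx].
by apply: (Aspace_orthogonal yx); [exact: hA|exact: Ag].
Qed.

Lemma fvec_eq_size x y : size x = size y -> fvec x y = (x == y)%:R.
Proof.
move=> s; rewrite /Defs.fvec; case: ifPn => [/suffix_size_eq/(_ s) ->|].
  by rewrite eqxx /vseq subnn.
by case: eqP => // ->; rewrite suffix_refl.
Qed.

Lemma fvec_lt_size x y : (size y < size x)%N -> fvec x y = 0.
Proof. by move=> lt; rewrite /Defs.fvec; case: ifP => // /size_suffix; rewrite leqNgt lt. Qed.

(** If u = h - g vanishes up to level n, then J u = z u at a vertex x of level n reduces to lambda_n
    times the sum of the u(x_i) being 0. The values of u at the children are thus admissible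
    coefficients for A_x, and adding these elements corrects level n + 1 without changing earlier
    levels. *)
Lemma level_approx h n : N h -> exists g, [/\ lspan (\bigcup_o A o) g,
  forall y, (size y <= n)%N -> g y = h y &
  forall u, N u -> (forall y, (size y <= n)%N -> u y = 0) -> dotl2 g u = 0].
Proof.
move=> Nh; elim: n => [|n [g [Sg gh go]]].
  exists (h [::] *: fvec [::]); split.
  - by apply: sub_lspan; exists None => //; exists (h [::]).
  - move=> y; rewrite leqn0 size_eq0 => /eqP ->.
    by rewrite fctE scaleCE fvec_eq_size// eqxx mulr1.
  - move=> u Nu u0; have [hu _] := Nu.
    by rewrite dotZl ?fvec_orth ?mulr0 ?u0//; exact: ell2_fvec.
have Ng : N g.
  apply: lspan_le Sg => [u [x _]||]; [exact: Aspace_deficiency|exact: deficiency0|].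
  exact: deficiency_lin.
pose u := -1 *: g + h; have Nu : N u by exact: deficiency_lin.
have uE y : u y = h y - g y by rewrite /u !fctE scaleCE mulN1r addrC.
have u0 y : (size y <= n)%N -> u y = 0 by move=> /gh; rewrite uE => ->; rewrite subrr.
have [_ /deficiencyP [_ Ju]] : True /\ N u by [].
have usum x : size x = n -> \sum_(i < d) u (i :: x) = 0.
  move=> sx; have := congr1 (fun f => f x) Ju.
  rewrite /Jform fctE scaleCE u0 ?sx// !mulr0 addr0.
  have -> : (if x is _ :: x0 then (lam (size x0))%:C * u x0 else 0) = 0.
    by case: x sx => // j x /= sx; rewrite u0 ?mulr0// -sx.
  rewrite add0r => /eqP; rewrite mulf_eq0.
  by rewrite (negbTE (lamC_neq0 lam_gt0 n))/= => /eqP.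
(* Tuples enumerate level n. On level n + 1 each f_(x_i) equals delta_(x_i), so the corrections do
   not interfere. *)
pose p (t : n.-tuple 'I_d) := \sum_(i < d) u (i :: t) *: fvec (i :: t).
exists (1 *: g + \sum_t p t); split.
- apply: lspan_lin => //; apply: lspan_sum => t _; apply: sub_lspan.
  by exists (Some (val t)) => //; exists (fun i => u (i :: t)); split; rewrite ?usum ?size_tuple.
- move=> y; rewrite leq_eqVlt ltnS => /orP[/eqP sy|sy]; rewrite scale1r fctE fct_sumE.
    case: y sy => // j y /= [/eqP sy].
    rewrite (bigD1 (Tuple sy))//= big1 ?addr0 => [|t ty].
      rewrite /p fct_sumE (bigD1 j)//= big1 ?addr0 => [|i ij].
        by rewrite fctE scaleCE fvec_eq_size// eqxx mulr1 uE addrC subrK.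
      by rewrite fctE scaleCE fvec_eq_size// eqseq_cons (negbTE ij) mulr0.
    rewrite /p fct_sumE big1// => i _; rewrite fctE scaleCE fvec_eq_size; last first.
      by rewrite /= size_tuple (eqP sy).
    rewrite eqseq_cons; case: (i =P j) => //= _; last by rewrite mulr0.
    case: eqP => [E|_]; last by rewrite mulr0.
    by case/eqP: ty; exact: val_inj.
  rewrite gh// big1 ?addr0// => t _; rewrite /p fct_sumE big1// => i _.
  by rewrite fctE scaleCE fvec_lt_size ?mulr0//= size_tuple.
- move=> w Nw w0; have [hw _] := Nw; have [hg _] := Ng.
  have hp t : ell2 (p t) by apply: ell2_sum => i _; exact/ell2Z/ell2_fvec.
  rewrite scale1r dotDl//; last exact: ell2_sum.
  rewrite go//; last by move=> y yn; apply: w0; exact: leqW.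
  rewrite add0r dot_suml// big1// => t _.
  rewrite dot_suml//; last by move=> i _; exact/ell2Z/ell2_fvec.
  rewrite big1// => i _; rewrite dotZl//; last exact: ell2_fvec.
  by rewrite fvec_orth ?mulr0// w0 //= size_tuple.
Qed.

Lemma lspan_dense : dense_in (lspan (\bigcup_o A o)) N.
Proof.
have sub : lspan (\bigcup_o A o) `<=` N.
  apply: lspan_le => [u [x _]||]; [exact: Aspace_deficiency|exact: deficiency0|].
  exact: deficiency_lin.
split => // h Nh e e0; have [hh _] := Nh.
have [X finX HX] := restr_approx hh e0; have [n Xn] := finite_set_ball finX.
set Y := [set y | (size y <= n)%N] in Xn.
have [g [Sg gh go]] := level_approx n Nh; exists g => //.
have Ng := sub _ Sg; have [hg _] := Ng.
have Nu : N (h - g) by rewrite addrC -scaleN1r; exact: deficiency_lin.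
have [hu _] := Nu; have hr := ell2_restr Y hh.
have [->//|n0] := eqVneq (norml2 (h - g)) 0.
have np : 0 < norml2 (h - g) by rewrite lt_neqAle eq_sym n0 norml2_ge0.
apply: le_lt_trans (HX _ Xn).
rewrite -(ler_pM2r np) -expr2 sqr_norml2.
apply: le_trans (cauchy_schwarz (ell2B hh hr) hu).
rewrite -[leLHS]ger0_norm ?nsq_ge0// -normcR -dotff//.
rewrite dotBl// go//; last by move=> y yn; rewrite !fctE gh ?subrr.
rewrite subr0 dotBl//.
(* The two factors have disjoint supports: h - g is 0 on Y. *)
rewrite (_ : dotl2 (restr Y h) (h - g) = 0) ?subr0//.
rewrite -(dot0l hu) /dotl2; congr csum; apply: funext => y.
rewrite /restr mul0r; case: ifPn => [/set_mem yn|_]; last by rewrite mul0r.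
by rewrite !fctE gh// subrr conjC0 mulr0.
Qed.

Lemma deficiency_nontrivial : exists2 h, N h & h != 0.
Proof.
exists (fvec [::]).
  by apply: (@Aspace_deficiency None); exists 1; rewrite scale1r.
apply/eqP => /(congr1 (fun f => f [::])) /eqP.
by rewrite fvec_eq_size// eqxx oner_eq0.
Qed.

End DeficiencySpace.

Theorem theorem1p17 (R : realType) (d : nat) (lam beta : nat -> R) (z : R[i])
  (d_ge2 : (2 <= d)%N)
  (lam_gt0 : forall n : nat, 0 < lam n)
  (nesa : ~ essentially_selfadjoint (@Jacobi R d lam beta))
  (z_nonreal : complex.Im z != 0) :
  let N : set (vertex d -> R[i]) := deficiency (@Jacobi R d lam beta) z in
  let A : option (vertex d) -> set (vertex d -> R[i]) :=
    @Aspace R d lam beta z in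
  [/\ (exists2 h, N h & h != 0),
      orthogonal_family A,
      direct_family A,
      algsum A = lspan (\bigcup_x A x) &
      dense_in (algsum A) N].
Proof.
move=> N A; have d_gt0 : (0 < d)%N := ltnW d_ge2.
have algE : algsum A = lspan (\bigcup_x A x).
  by apply: algsum_lspan; [exact: Aspace0|exact: Aspace_lin].
split => //.
- exact: deficiency_nontrivial.
- exact: Aspace_orthogonal.
- exact: Aspace_direct.
- by rewrite algE; exact: lspan_dense.
Qed.
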